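(* Consider the exact Heisenberg family of the context (parameters $m\ge1$, $n=2m+1$, $A_a>0$, $\phi_0$, $(p_0,\dots,p_{2m},q)$, $\chi_r>0$), and set $D=1+\sum_{r=1}^m\chi_r$. The future proper-time Kasner exponents and scalar slope are $$P_0=\frac{p_0-\sum_r\chi_r}D,\qquad P_{2r-1}=\frac{p_{2r-1}+\chi_r}D,\qquad P_{2r}=\frac{p_{2r}+\chi_r}D,\qquad Q=\frac qD .$$ They satisfy $\sum_aP_a=1$, $\sum_aP_a^2+Q^2=1$, and $1+P_0-P_{2r-1}-P_{2r}=-\chi_r/D$. For positive constants $A_a^+$ and some $\phi_+\in\mathbb R$, $$a_a(t)=A_a^+t^{P_a}(1+O(t^{-\epsilon})),\qquad\phi(t)=Q\log t+\phi_++O(t^{-\epsilon})\qquad(t\to\infty)$$ with two differentiated estimates (the same errors after one and two applications of $t\partial_t$) for every $0<\epsilon<\min\{1,2\min_r\chi_r/D\}$. Writing $\Omega_\phi=\rho_\phi/\rho_{\rm crit}$ with $\rho_{\rm crit}=(n-1)\theta^2/(2n)$, the limits $\Omega_{\phi,-}$ as $t\downarrow0$ and $\Omega_{\phi,+}$ as $t\to\infty$ are $$\Omega_{\phi,-}=\frac{nq^2}{n-1},\qquad\Omega_{\phi,+}=\frac{\Omega_{\phi,-}}{D^2}.$$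
   Context: $H_{2m+1}$ has left-invariant coframe $\omega^0,\dots,\omega^{2m}$ with $\mathrm d\omega^0=-\sum_{r=1}^m\omega^{2r-1}\wedge\omega^{2r}$ and $\mathrm d\omega^i=0$ for $i\ge1$. The data satisfy $\sum_ap_a=1$, $\sum_ap_a^2+q^2=1$, $\chi_r=1+p_0-p_{2r-1}-p_{2r}>0$ for $1\le r\le m$. With $\kappa_r=A_0/(A_{2r-1}A_{2r})$ and $F_r(\tau)=1+\frac{\kappa_r^2}{4\chi_r^2}e^{2\chi_r\tau}$, the exact family is $g=-N^2\mathrm d\tau^2+\sum_aa_a^2(\omega^a)^2$, $\tau\in\mathbb R$, with $a_0=A_0e^{p_0\tau}\prod_rF_r^{-1/2}$, $a_{2r-1}=A_{2r-1}e^{p_{2r-1}\tau}F_r^{1/2}$, $a_{2r}=A_{2r}e^{p_{2r}\tau}F_r^{1/2}$, $N=e^\tau\prod_rF_r^{1/2}$, $\phi=q\tau+\phi_0$; it solves $\operatorname{Ric}(g)=\mathrm d\phi\otimes\mathrm d\phi$, $\Box_g\phi=0$. Proper time is $t=\int_{-\infty}^\tau N\in(0,\infty)$. $\theta=\sum_a\dot a_a/a_a$ and $\rho_\phi=\dot\phi^2/2$, with dots denoting $t$-derivatives. *)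

(* Defs.v *)
From Stdlib Require Import Reals Lra Lia Psatz.
From Coquelicot Require Import Coquelicot.
Open Scope R_scope.

(* Families indexed by a = 0..2m or by r = 1..m are functions on nat; their
   values outside the range are never used. *)

Fixpoint prod_1 (f : nat -> R) (m : nat) : R :=
  match m with
  | O => 1
  | S k => prod_1 f k * f (S k)
  end.

(* For m >= 1 this is min (f 1) .. (f m); the value at m = 0 is irrelevant. *)
Fixpoint min_1 (f : nat -> R) (m : nat) : R :=
  match m with
  | O => f 1%nat
  | S k => Rmin (min_1 f k) (f (S k))
  end.

(* The r such that a = 2r-1 or a = 2r, for a >= 1. *)
Definition block (a : nat) : nat := Nat.div2 (S a).

Lemma block_odd r : (1 <= r)%nat -> block (2 * r - 1) = r.
Proof.
intros hr; unfold block; replace (S (2 * r - 1)) with (2 * r)%nat by lia.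
apply Nat.div2_double.
Qed.

Lemma block_even r : block (2 * r) = r.
Proof. apply Nat.div2_succ_double. Qed.

Definition chi (p : nat -> R) (r : nat) : R :=
  1 + p 0%nat - p (2 * r - 1)%nat - p (2 * r)%nat.

Definition kappa (A : nat -> R) (r : nat) : R :=
  A 0%nat / (A (2 * r - 1)%nat * A (2 * r)%nat).

Definition F (A p : nat -> R) (r : nat) (tau : R) : R :=
  1 + (kappa A r) ^ 2 / (4 * (chi p r) ^ 2) * exp (2 * chi p r * tau).

(* The metric is g = - N^2 dtau^2 + sum_a a_a^2 (omega^a)^2 with N = lapse and
   a_a = scale_factor a. *)
Definition lapse (m : nat) (A p : nat -> R) (tau : R) : R :=
  exp tau * prod_1 (fun r => sqrt (F A p r tau)) m.

Definition scale_factor (m : nat) (A p : nat -> R) (a : nat) (tau : R) : R :=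
  match a with
  | O => A 0%nat * exp (p 0%nat * tau) * prod_1 (fun r => / sqrt (F A p r tau)) m
  | S _ => A a * exp (p a * tau) * sqrt (F A p (block a) tau)
  end.

Definition scalar_field (q phi0 tau : R) : R := q * tau + phi0.

Definition proper_time (m : nat) (A p : nat -> R) (tau : R) : R :=
  RInt_gen (lapse m A p) (Rbar_locally m_infty) (at_point tau).

(* The inverse of proper_time on (0, +oo): iota picks the unique solution. *)
Definition tau_of (m : nat) (A p : nat -> R) (t : R) : R :=
  iota (T := R_CompleteSpace) (fun tau : R => proper_time m A p tau = t).

Definition scale_factor_t (m : nat) (A p : nat -> R) (a : nat) (t : R) : R :=
  scale_factor m A p a (tau_of m A p t).

Definition scalar_field_t (m : nat) (A p : nat -> R) (q phi0 t : R) : R :=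
  scalar_field q phi0 (tau_of m A p t).

Definition theta (m : nat) (A p : nat -> R) (t : R) : R :=
  sum_n_m (fun a => Derive (scale_factor_t m A p a) t / scale_factor_t m A p a t)
    0 (2 * m).

Definition rho_phi (m : nat) (A p : nat -> R) (q phi0 t : R) : R :=
  (Derive (scalar_field_t m A p q phi0) t) ^ 2 / 2.

Definition rho_crit (m : nat) (A p : nat -> R) (t : R) : R :=
  (INR (2 * m + 1) - 1) * (theta m A p t) ^ 2 / (2 * INR (2 * m + 1)).

Definition Omega_phi (m : nat) (A p : nat -> R) (q phi0 t : R) : R :=
  rho_phi m A p q phi0 t / rho_crit m A p t.

Definition Dsum (m : nat) (p : nat -> R) : R := 1 + sum_n_m (chi p) 1 m.

Definition Pfut (m : nat) (p : nat -> R) (a : nat) : R :=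
  match a with
  | O => (p 0%nat - sum_n_m (chi p) 1 m) / Dsum m p
  | S _ => (p a + chi p (block a)) / Dsum m p
  end.

Definition Qfut (m : nat) (p : nat -> R) (q : R) : R := q / Dsum m p.

Definition is_O_infty (eps : R) (f : R -> R) : Prop :=
  exists C T : R, 0 < T /\
    forall t, T <= t -> Rabs (f t) <= C * Rpower t (- eps).

Definition t_deriv (f : R -> R) (t : R) : R := t * Derive f t.

(* Derive is total, so differentiability has to be required separately. *)
Definition is_O2_infty (eps : R) (f : R -> R) : Prop :=
  (forall t, 0 < t -> ex_derive f t /\ ex_derive (t_deriv f) t) /\
  is_O_infty eps f /\
  is_O_infty eps (t_deriv f) /\
  is_O_infty eps (t_deriv (t_deriv f)).

(* Proper time is well defined and maps R bijectively onto (0, +oo). *)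

Lemma F_ge_1 A p r tau : 1 <= F A p r tau.
Proof.
unfold F.
assert (H : 0 <= kappa A r ^ 2 / (4 * chi p r ^ 2) * exp (2 * chi p r * tau)).
{ apply Rmult_le_pos; [|apply Rlt_le, exp_pos].
  unfold Rdiv; apply Rmult_le_pos; [apply pow2_ge_0|].
  destruct (Req_dec (4 * chi p r ^ 2) 0) as [E|E].
  - rewrite E, Rinv_0; lra.
  - apply Rlt_le, Rinv_0_lt_compat; pose proof (pow2_ge_0 (chi p r)); lra. }
lra.
Qed.

Lemma prod_sqrtF_ge_1 A p m tau : 1 <= prod_1 (fun r => sqrt (F A p r tau)) m.
Proof.
induction m as [|m IH]; simpl; [lra|].
assert (1 <= sqrt (F A p (S m) tau)).
{ rewrite <- sqrt_1; apply sqrt_le_1_alt, F_ge_1. }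
nra.
Qed.

Lemma prod_sqrtF_incr A p m s t :
  (forall r, (1 <= r <= m)%nat -> 0 < chi p r) -> s <= t ->
  prod_1 (fun r => sqrt (F A p r s)) m <= prod_1 (fun r => sqrt (F A p r t)) m.
Proof.
intros hchi hst; induction m as [|m IH]; simpl; [lra|].
assert (sqrt (F A p (S m) s) <= sqrt (F A p (S m) t)).
{ apply sqrt_le_1_alt; unfold F; apply Rplus_le_compat_l, Rmult_le_compat_l.
  - unfold Rdiv; apply Rmult_le_pos; [apply pow2_ge_0|].
    assert (hc := hchi (S m) ltac:(lia)).
    apply Rlt_le, Rinv_0_lt_compat; nra.
  - assert (hc := hchi (S m) ltac:(lia)).
    destruct (Req_dec s t) as [->|]; [lra|].
    apply Rlt_le, exp_increasing; nra. }
apply Rmult_le_compat; auto.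
- pose proof (prod_sqrtF_ge_1 A p m s); lra.
- apply sqrt_pos.
- apply IH; intros r hr; apply hchi; lia.
Qed.

Lemma lapse_pos m A p tau : 0 < lapse m A p tau.
Proof.
apply Rmult_lt_0_compat; [apply exp_pos|].
pose proof (prod_sqrtF_ge_1 A p m tau); lra.
Qed.

Lemma continuous_lapse m A p tau : continuous (lapse m A p) tau.
Proof.
apply (continuous_mult (K := R_AbsRing) exp).
- apply (ex_derive_continuous (V := R_NormedModule) exp); auto_derive; auto.
- induction m as [|m IH]; simpl; [apply continuous_const|].
  apply (continuous_mult (K := R_AbsRing) (fun t => prod_1 (fun r => sqrt (F A p r t)) m)); [exact IH|].
  apply (ex_derive_continuous (V := R_NormedModule) (fun t => sqrt (F A p (S m) t))).
  apply (ex_derive_comp sqrt (F A p (S m))).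
  + exists (/ (2 * sqrt (F A p (S m) tau))).
    apply is_derive_Reals, derivable_pt_lim_sqrt.
    pose proof (F_ge_1 A p (S m) tau); lra.
  + unfold F; auto_derive; auto.
Qed.

Lemma ex_RInt_lapse m A p a b : ex_RInt (lapse m A p) a b.
Proof.
apply (ex_RInt_continuous (V := R_CompleteNormedModule)).
intros; apply continuous_lapse.
Qed.

Lemma RInt_exp a b : is_RInt exp a b (exp b - exp a).
Proof.
apply (is_RInt_derive (V := R_CompleteNormedModule) exp exp); intros;
  [|apply (ex_derive_continuous (V := R_NormedModule) exp)]; auto_derive; auto; ring.
Qed.

Lemma RInt_lapse_le m A p a b :
  (forall r, (1 <= r <= m)%nat -> 0 < chi p r) -> a <= b ->
  RInt (lapse m A p) a b
    <= prod_1 (fun r => sqrt (F A p r b)) m * exp b.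
Proof.
intros hchi hab.
set (K := prod_1 (fun r => sqrt (F A p r b)) m).
assert (hK : 1 <= K) by apply prod_sqrtF_ge_1.
assert (hI : is_RInt (fun x => K * exp x) a b (K * (exp b - exp a))).
{ apply (is_RInt_scal (V := R_NormedModule) exp); apply RInt_exp. }
apply Rle_trans with (K * (exp b - exp a)).
- rewrite <- (is_RInt_unique _ _ _ _ hI).
  apply RInt_le; auto.
  + apply ex_RInt_lapse.
  + eexists; exact hI.
  + intros x hx; unfold lapse; rewrite Rmult_comm.
    apply Rmult_le_compat_r; [apply Rlt_le, exp_pos|].
    apply prod_sqrtF_incr; auto; lra.
- pose proof (exp_pos a); nra.
Qed.

Lemma RInt_lapse_ge m A p a b :
  a <= b -> exp b - exp a <= RInt (lapse m A p) a b.
Proof.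
intros hab; rewrite <- (is_RInt_unique _ _ _ _ (RInt_exp a b)).
apply RInt_le; auto.
- eexists; apply RInt_exp.
- apply ex_RInt_lapse.
- intros x _; unfold lapse; pose proof (exp_pos x);
  pose proof (prod_sqrtF_ge_1 A p m x); nra.
Qed.

Lemma is_RInt_gen_lapse m A p tau :
  (forall r, (1 <= r <= m)%nat -> 0 < chi p r) ->
  is_RInt_gen (lapse m A p) (Rbar_locally m_infty) (at_point tau)
    (proper_time m A p tau).
Proof.
intros hchi.
apply (RInt_gen_correct (V := R_CompleteNormedModule) (lapse m A p)).
destruct (completeness
  (fun y => exists x, x <= tau /\ y = RInt (lapse m A p) x tau)) as [l [hub hlub]].
- exists (prod_1 (fun r => sqrt (F A p r tau)) m * exp tau).
  intros y [x [hx ->]]; apply RInt_lapse_le; auto.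
- exists (RInt (lapse m A p) tau tau), tau; split; [lra|auto].
- exists l; apply filterlimi_locally; intros eps.
  assert (hex : exists x0, x0 <= tau /\ l - eps < RInt (lapse m A p) x0 tau).
  { apply Classical_Prop.NNPP; intros hn.
    assert (l <= l - eps); [|pose proof (cond_pos eps); lra].
    apply hlub; intros y [x [hx ->]].
    apply Rnot_lt_le; intros h; apply hn; exists x; auto. }
  destruct hex as [x0 [hx0 hl]].
  apply Filter_prod with (fun x => x < x0) (fun y => y = tau).
  + exists x0; auto.
  + reflexivity.
  + intros x y hx ->; exists (RInt (lapse m A p) x tau); split.
    * apply (RInt_correct (V := R_CompleteNormedModule) (lapse m A p)), ex_RInt_lapse.
    * assert (RInt (lapse m A p) x tau <= l).
      { apply hub; exists x; split; [lra|auto]. }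
      assert (hc := RInt_Chasles (V := R_CompleteNormedModule) (lapse m A p) x x0 tau
                (ex_RInt_lapse _ _ _ _ _) (ex_RInt_lapse _ _ _ _ _)).
      pose proof (RInt_lapse_ge m A p x x0 ltac:(lra)).
      assert (exp x < exp x0) by (apply exp_increasing; auto).
      unfold plus in hc; simpl in hc.
      apply Rabs_def1; unfold minus, plus, opp; simpl; lra.
Qed.

Lemma proper_time_Chasles m A p s t :
  (forall r, (1 <= r <= m)%nat -> 0 < chi p r) ->
  proper_time m A p t = proper_time m A p s + RInt (lapse m A p) s t.
Proof.
intros hchi; unfold proper_time at 1; 
  apply (is_RInt_gen_unique (V := R_CompleteNormedModule) (lapse m A p)).
apply (is_RInt_gen_Chasles _ s (proper_time m A p s) (RInt (lapse m A p) s t)).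
- apply is_RInt_gen_lapse; auto.
- apply is_RInt_gen_at_point, (RInt_correct (V := R_CompleteNormedModule) (lapse m A p)), ex_RInt_lapse.
Qed.

Lemma proper_time_increasing m A p s t :
  (forall r, (1 <= r <= m)%nat -> 0 < chi p r) -> s < t ->
  proper_time m A p s < proper_time m A p t.
Proof.
intros hchi hst; rewrite (proper_time_Chasles m A p s t hchi).
pose proof (RInt_lapse_ge m A p s t ltac:(lra)).
pose proof (exp_increasing s t hst); lra.
Qed.

Lemma is_derive_proper_time m A p tau :
  (forall r, (1 <= r <= m)%nat -> 0 < chi p r) ->
  is_derive (proper_time m A p) tau (lapse m A p tau).
Proof.
intros hchi.
apply is_derive_ext with
  (fun t => proper_time m A p tau + RInt (lapse m A p) tau t).
{ intros t; symmetry; apply proper_time_Chasles; auto. }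
rewrite <- (Rplus_0_l (lapse m A p tau)).
apply (is_derive_plus (fun _ => proper_time m A p tau)); [apply @is_derive_const|].
apply (is_derive_RInt _ _ tau); [|apply continuous_lapse].
apply filter_forall; intros t.
apply (RInt_correct (V := R_CompleteNormedModule) (lapse m A p)), ex_RInt_lapse.
Qed.

Lemma proper_time_bounds m A p tau :
  (forall r, (1 <= r <= m)%nat -> 0 < chi p r) ->
  exp tau <= proper_time m A p tau
    <= prod_1 (fun r => sqrt (F A p r tau)) m * exp tau.
Proof.
intros hchi.
set (K := prod_1 (fun r => sqrt (F A p r tau)) m).
assert (hg : forall eps : posreal, exists x, x <= tau /\ exp x < eps /\
  Rabs (RInt (lapse m A p) x tau - proper_time m A p tau) < eps).
{ intros eps.
  assert (h := is_RInt_gen_lapse m A p tau hchi).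
  unfold is_RInt_gen in h; rewrite filterlimi_locally in h; specialize (h eps).
  destruct h as [P Q [M hM] hQ h].
  set (x := Rmin (M - 1) (Rmin tau (ln eps - 1))).
  assert (x <= M - 1) by apply Rmin_l.
  assert (x <= Rmin tau (ln eps - 1)) by apply Rmin_r.
  pose proof (Rmin_l tau (ln eps - 1)); pose proof (Rmin_r tau (ln eps - 1)).
  destruct (h x tau (hM x ltac:(lra)) hQ) as [z [hz hb]].
  exists x; split; [lra|split].
  - rewrite <- (exp_ln eps (cond_pos eps)); apply exp_increasing; lra.
  - simpl in hz; rewrite (is_RInt_unique _ _ _ _ hz); exact hb. }
split; apply Rnot_lt_le; intros hlt.
- destruct (hg (mkposreal ((exp tau - proper_time m A p tau) / 2) ltac:(lra)))
    as [x [hx [he ha]]]; simpl in he, ha.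
  pose proof (RInt_lapse_ge m A p x tau hx).
  apply Rabs_def2 in ha; lra.
- destruct (hg (mkposreal (proper_time m A p tau - K * exp tau) ltac:(lra)))
    as [x [hx [_ ha]]]; simpl in ha.
  pose proof (RInt_lapse_le m A p x tau hchi hx) as hu; fold K in hu.
  apply Rabs_def2 in ha; lra.
Qed.

Lemma proper_time_pos m A p tau :
  (forall r, (1 <= r <= m)%nat -> 0 < chi p r) -> 0 < proper_time m A p tau.
Proof.
intros hchi; pose proof (proper_time_bounds m A p tau hchi).
pose proof (exp_pos tau); lra.
Qed.

Lemma proper_time_tau_of m A p t :
  (forall r, (1 <= r <= m)%nat -> 0 < chi p r) -> 0 < t ->
  proper_time m A p (tau_of m A p t) = t.
Proof.
intros hchi ht; unfold tau_of.
set (K := prod_1 (fun r => sqrt (F A p r 0)) m).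
assert (hK : 1 <= K) by apply prod_sqrtF_ge_1.
set (a := Rmin (-1) (ln (t / (2 * K)))); set (b := Rmax 0 (ln (2 * t))).
assert (htK : 0 < t / (2 * K)) by (apply Rdiv_lt_0_compat; lra).
assert (ha : proper_time m A p a < t).
{ pose proof (Rmin_l (-1) (ln (t / (2 * K)))) as h1.
  pose proof (Rmin_r (-1) (ln (t / (2 * K)))) as h2; fold a in h1, h2.
  pose proof (proper_time_bounds m A p a hchi) as [_ hu].
  pose proof (prod_sqrtF_incr A p m a 0 hchi ltac:(lra)) as hi; fold K in hi.
  assert (exp a <= t / (2 * K)).
  { rewrite <- (exp_ln _ htK); destruct h2 as [h2|h2];
      [apply Rlt_le, exp_increasing; auto|rewrite h2; lra]. }
  pose proof (exp_pos a).
  assert (K * (t / (2 * K)) = t / 2) by (field; lra).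
  nra. }
assert (hb : t < proper_time m A p b).
{ pose proof (Rmax_r 0 (ln (2 * t))) as h2; fold b in h2.
  pose proof (proper_time_bounds m A p b hchi) as [hu _].
  assert (2 * t <= exp b).
  { rewrite <- (exp_ln (2 * t)) by lra; destruct h2 as [h2|h2];
      [apply Rlt_le, exp_increasing; auto|rewrite h2; lra]. }
  lra. }
assert (hab : a < b).
{ pose proof (Rmin_l (-1) (ln (t / (2 * K)))) as h1.
  pose proof (Rmax_l 0 (ln (2 * t))) as h2; fold a in h1; fold b in h2; lra. }
assert (hcont : continuity (fun x => proper_time m A p x - t)).
{ intros x; apply continuity_pt_filterlim.
  apply (ex_derive_continuous (fun x => proper_time m A p x - t)).
  exists (lapse m A p x).
  rewrite <- (Rminus_0_r (lapse m A p x)).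
  apply (is_derive_minus (proper_time m A p) (fun _ => t));
    [apply is_derive_proper_time; auto|apply @is_derive_const]. }
destruct (IVT _ a b hcont hab) as [z [_ hz]]; [lra|lra|].
apply (iota_correct (K := R_AbsRing) (V := R_CompleteNormedModule)
  (fun tau => proper_time m A p tau = t)).
exists z; split; [lra|]; intros y hy.
destruct (Rtotal_order z y) as [h|[h|h]]; auto;
  apply (proper_time_increasing m A p _ _ hchi) in h; lra.
Qed.

(* Main.v *)
Require Import Defs.
From Stdlib Require Import Reals Lra Lia Ranalysis5.
From Coquelicot Require Import Coquelicot.
Open Scope R_scope.

(** In the variable [tau] every quantity has an explicit logarithmic derivative:
    with [h = N' / N = D - sum_r chi_r / F_r] one has [theta = h / N], so that
    [Omega_phi = n q^2 / ((n - 1) h^2)], and [h] runs from [1] to [D].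

    For the asymptotics, let [s = t / N], so that [t d/dt = s d/dtau] and
    [s' = 1 - s h].  The lag [t - N / D] is nonnegative with derivative
    [N (D - h) / D = O(exp ((D - b) tau))] for every [b < D] with
    [b <= 2 chi_r], hence [1 - D s = O(exp (- b tau))].  This is where the
    restriction on [epsilon = b / D] comes from.  The functions
    [ln t - D tau], [ln F_r - 2 chi_r tau] and their [t d/dt]-derivatives are
    polynomials in [s], [h] and [1 / F_r], up to the logarithms of [D s] and of
    [1 + exp (- 2 chi_r tau) / k_r], so all their errors decay at that rate. *)

(* Equations between [sum_n_m]s are typed in a Coquelicot structure, which
   [ring] and [field] do not see through. *)
Ltac change_eq_R := match goal with |- @eq _ ?x ?y => change (@eq R x y) end.

(** * Sums and products over the blocks of the coframe *)

Lemma sum_n_m_even_split (f : nat -> R) (m : nat) :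
  sum_n_m f 0 (2 * m) =
  f 0%nat + sum_n_m (fun r => f (2 * r - 1)%nat + f (2 * r)%nat) 1 m.
Proof.
induction m as [|m IH].
- simpl; rewrite sum_n_n, sum_n_m_zero by lia; unfold zero; simpl; ring.
- replace (2 * S m)%nat with (S (S (2 * m))) by lia.
  rewrite !sum_n_Sm by lia; rewrite IH.
  replace (2 * S m - 1)%nat with (S (2 * m)) by lia.
  replace (2 * S m)%nat with (S (S (2 * m))) by lia.
  unfold plus; simpl; ring.
Qed.

Lemma sum_n_m_Rplus (f g : nat -> R) (i j : nat) :
  sum_n_m (fun r => f r + g r) i j = sum_n_m f i j + sum_n_m g i j.
Proof. exact (sum_n_m_plus f g i j). Qed.

Lemma sum_n_m_Rscal (c : R) (f : nat -> R) (i j : nat) :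
  sum_n_m (fun r => c * f r) i j = c * sum_n_m f i j.
Proof. exact (sum_n_m_scal_l (V := R_ModuleSpace) c f i j). Qed.

Lemma sum_1_nonneg (f : nat -> R) (m : nat) :
  (forall r, (1 <= r <= m)%nat -> 0 <= f r) -> 0 <= sum_n_m f 1 m.
Proof.
intros hf; induction m as [|m IH].
- rewrite sum_n_m_zero by lia; unfold zero; simpl; lra.
- rewrite sum_n_Sm by lia; unfold plus; simpl.
  pose proof (hf (S m) ltac:(lia)).
  assert (0 <= sum_n_m f 1 m) by (apply IH; intros; apply hf; lia); lra.
Qed.

Lemma min_1_le (f : nat -> R) (m r : nat) :
  (1 <= r <= m)%nat -> min_1 f m <= f r.
Proof.
induction m as [|m IH]; intros hr; [lia|simpl].
destruct (Nat.eq_dec r (S m)) as [->|]; [apply Rmin_r|].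
apply Rle_trans with (min_1 f m); [apply Rmin_l|apply IH; lia].
Qed.

Lemma prod_1_pos (f : nat -> R) (m : nat) :
  (forall r, (1 <= r <= m)%nat -> 0 < f r) -> 0 < prod_1 f m.
Proof.
intros hf; induction m as [|m IH]; simpl; [lra|].
apply Rmult_lt_0_compat; [apply IH; intros; apply hf|apply hf]; lia.
Qed.

Lemma prod_1_inv (f : nat -> R) (m : nat) :
  prod_1 (fun r => / f r) m = / prod_1 f m.
Proof.
induction m as [|m IH]; simpl; [rewrite Rinv_1; auto|].
rewrite IH, Rinv_mult; auto.
Qed.

(** * Algebra of the future exponents *)

Lemma Dsum_ge_1 m p :
  (forall r, (1 <= r <= m)%nat -> 0 < chi p r) -> 1 <= Dsum m p.
Proof.
intros hchi; unfold Dsum.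
assert (0 <= sum_n_m (chi p) 1 m); [|lra].
apply sum_1_nonneg; intros r hr; specialize (hchi r hr); lra.
Qed.

Lemma block_cases (m a : nat) :
  (1 <= a <= 2 * m)%nat ->
  (1 <= block a <= m)%nat /\ (a = 2 * block a - 1 \/ a = 2 * block a)%nat.
Proof.
intros ha; destruct (Nat.Even_or_Odd a) as [[r ->]|[r ->]].
- rewrite block_even; lia.
- replace (2 * r + 1)%nat with (2 * S r - 1)%nat in * by lia.
  rewrite block_odd; lia.
Qed.

(** [Pfut] matches on its index, so it unfolds only once [2 * r - 1] is seen to be a successor. *)
Lemma Pfut_odd m p r : (1 <= r)%nat ->
  Pfut m p (2 * r - 1) = (p (2 * r - 1)%nat + chi p r) / Dsum m p.
Proof.
intros hr; rewrite <- (block_odd r hr) at 3.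
destruct (2 * r - 1)%nat eqn:E; [lia|reflexivity].
Qed.

Lemma Pfut_even m p r : (1 <= r)%nat ->
  Pfut m p (2 * r) = (p (2 * r)%nat + chi p r) / Dsum m p.
Proof.
intros hr; rewrite <- (block_even r) at 3.
destruct (2 * r)%nat eqn:E; [lia|reflexivity].
Qed.

(** With [S] the sum of the [chi_r], direction 0 loses [S] and each block gains [2 * chi_r], so the
    numerators add up to [1 - S + 2 * S = D]. *)
Lemma sum_Pfut m p :
  Dsum m p <> 0 -> sum_n_m p 0 (2 * m) = 1 -> sum_n_m (Pfut m p) 0 (2 * m) = 1.
Proof.
intros hD; rewrite !sum_n_m_even_split; intros hsum.
rewrite (sum_n_m_ext_loc _ (fun r => / Dsum m p *
  ((p (2 * r - 1)%nat + p (2 * r)%nat) + 2 * chi p r))).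
- rewrite sum_n_m_Rscal, sum_n_m_Rplus, sum_n_m_Rscal.
  set (X := sum_n_m (fun r => p (2 * r - 1)%nat + p (2 * r)%nat) 1 m) in *.
  replace X with (1 - p 0%nat) by lra.
  unfold Pfut, Dsum in *; change_eq_R; field; auto.
- intros r hr; rewrite Pfut_odd, Pfut_even by lia; change_eq_R; field; auto.
Qed.

(** With [S] the sum of the [chi_r], the squared numerators and [q ^ 2] add up to [1 - 2 p_0 S + S ^
    2 + 2 (1 + p_0) S = (1 + S) ^ 2 = D ^ 2]. *)
Lemma sum_sq_Pfut m p q :
  Dsum m p <> 0 ->
  sum_n_m (fun a => p a ^ 2) 0 (2 * m) + q ^ 2 = 1 ->
  sum_n_m (fun a => Pfut m p a ^ 2) 0 (2 * m) + Qfut m p q ^ 2 = 1.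
Proof.
intros hD; rewrite !sum_n_m_even_split; intros hsum.
(* [p_(2r-1) + p_(2r) = 1 + p_0 - chi_r] cancels the terms in [chi_r ^ 2]. *)
rewrite (sum_n_m_ext_loc _ (fun r => / Dsum m p ^ 2 *
  ((p (2 * r - 1)%nat ^ 2 + p (2 * r)%nat ^ 2) + 2 * (1 + p 0%nat) * chi p r))).
- rewrite sum_n_m_Rscal, sum_n_m_Rplus, sum_n_m_Rscal.
  unfold Pfut, Qfut.
  set (X := sum_n_m (fun r => p (2 * r - 1)%nat ^ 2 + p (2 * r)%nat ^ 2) 1 m) in *.
  replace X with (1 - q ^ 2 - p 0%nat ^ 2) by lra.
  unfold Dsum in *; change_eq_R; field; auto.
- intros r hr; rewrite Pfut_odd, Pfut_even by lia.
  replace (2 * (1 + p 0%nat) * chi p r) with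
    (2 * (chi p r + p (2 * r - 1)%nat + p (2 * r)%nat) * chi p r)
    by (unfold chi; ring).
  change_eq_R; field; auto.
Qed.

(** Since [D - S = 1] for the sum [S] of the [chi_r], the numerator is [chi_r - 2 * chi_r]. *)
Lemma chi_Pfut m p r :
  Dsum m p <> 0 -> (1 <= r)%nat ->
  1 + Pfut m p 0 - Pfut m p (2 * r - 1) - Pfut m p (2 * r) = - chi p r / Dsum m p.
Proof.
intros hD hr; rewrite Pfut_odd, Pfut_even by lia.
unfold Pfut; apply (Rmult_eq_reg_r (Dsum m p)); auto.
field_simplify; auto; unfold Dsum, chi; ring.
Qed.

(** * Logarithmic derivatives in the time variable [tau] *)

Definition Fcoef (A p : nat -> R) (r : nat) : R :=
  kappa A r ^ 2 / (4 * chi p r ^ 2).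

Lemma Fcoef_pos m A p r :
  (forall a, (a <= 2 * m)%nat -> 0 < A a) ->
  (forall r, (1 <= r <= m)%nat -> 0 < chi p r) ->
  (1 <= r <= m)%nat -> 0 < Fcoef A p r.
Proof.
intros hA hchi hr; unfold Fcoef.
assert (0 < kappa A r).
{ apply Rdiv_lt_0_compat; [|apply Rmult_lt_0_compat]; apply hA; lia. }
specialize (hchi r hr).
apply Rdiv_lt_0_compat; nra.
Qed.

Lemma is_derive_F A p r tau :
  is_derive (F A p r) tau (2 * chi p r * (F A p r tau - 1)).
Proof.
unfold F; fold (Fcoef A p r); generalize (Fcoef A p r); intros k.
auto_derive; auto; ring.
Qed.

Lemma F_pos A p r tau : 0 < F A p r tau.
Proof. pose proof (F_ge_1 A p r tau); lra. Qed.

(** Derivatives are kept in the form function times logarithmic derivative, so that growth rates add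
    under products; here the rate is [F' / (2 F)]. *)
Lemma is_derive_sqrt_F A p r tau :
  is_derive (fun x => sqrt (F A p r x)) tau
    (sqrt (F A p r tau) * (chi p r * (1 - / F A p r tau))).
Proof.
pose proof (F_pos A p r tau) as hF.
pose proof (sqrt_lt_R0 _ hF).
evar_last.
- apply (is_derive_comp sqrt (F A p r)); [|apply is_derive_F].
  apply is_derive_Reals, derivable_pt_lim_sqrt; auto.
- unfold scal; simpl; unfold mult; simpl.
  assert (hs : sqrt (F A p r tau) * sqrt (F A p r tau) = F A p r tau)
    by (apply sqrt_sqrt; lra).
  set (y := sqrt (F A p r tau)) in *; rewrite <- hs; field; lra.
Qed.

Definition block_growth (m : nat) (A p : nat -> R) (tau : R) : R :=
  sum_n_m (fun r => chi p r * (1 - / F A p r tau)) 1 m.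

Lemma is_derive_prod_sqrt_F m A p tau :
  is_derive (fun x => prod_1 (fun r => sqrt (F A p r x)) m) tau
    (prod_1 (fun r => sqrt (F A p r tau)) m * block_growth m A p tau).
Proof.
unfold block_growth; induction m as [|m IH].
- rewrite sum_n_m_zero by lia; simpl; unfold zero; simpl.
  rewrite Rmult_0_r; apply @is_derive_const.
- rewrite sum_n_Sm by lia; simpl; evar_last.
  + apply (is_derive_mult (fun x => prod_1 (fun r => sqrt (F A p r x)) m)
      (fun x => sqrt (F A p (S m) x))); [exact IH|apply is_derive_sqrt_F|].
    intros; apply Rmult_comm.
  + unfold plus, mult; simpl; ring.
Qed.

(** The quantity [h = N' / N] of the overview. *)
Definition lapse_growth (m : nat) (A p : nat -> R) (tau : R) : R :=
  1 + block_growth m A p tau.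

Lemma is_derive_lapse m A p tau :
  is_derive (lapse m A p) tau (lapse m A p tau * lapse_growth m A p tau).
Proof.
evar_last.
- apply (is_derive_mult exp (fun x => prod_1 (fun r => sqrt (F A p r x)) m));
    [apply is_derive_Reals, derivable_pt_lim_exp|apply is_derive_prod_sqrt_F|].
  intros; apply Rmult_comm.
- unfold plus, mult, lapse, lapse_growth; simpl; ring.
Qed.

Definition scale_growth (m : nat) (A p : nat -> R) (a : nat) (tau : R) : R :=
  match a with
  | O => p 0%nat - block_growth m A p tau
  | S _ => p a + chi p (block a) * (1 - / F A p (block a) tau)
  end.

Lemma is_derive_scale_factor m A p a tau :
  is_derive (scale_factor m A p a) tau
    (scale_factor m A p a tau * scale_growth m A p a tau).
Proof.
destruct a as [|a]; unfold scale_factor, scale_growth.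
- pose proof (prod_sqrtF_ge_1 A p m tau) as hN.
  apply is_derive_ext with (fun x => A 0%nat * exp (p 0%nat * x) *
    / prod_1 (fun r => sqrt (F A p r x)) m).
  { intros x; rewrite prod_1_inv; auto. }
  rewrite prod_1_inv; evar_last.
  + apply (is_derive_mult (fun x => A 0%nat * exp (p 0%nat * x))
      (fun x => / prod_1 (fun r => sqrt (F A p r x)) m));
      [auto_derive; auto; reflexivity
      |apply is_derive_inv; [apply is_derive_prod_sqrt_F|lra]|].
    intros; apply Rmult_comm.
  + unfold plus, mult; simpl; field; lra.
- evar_last.
  + apply (is_derive_mult (fun x => A (S a) * exp (p (S a) * x))
      (fun x => sqrt (F A p (block (S a)) x)));
      [auto_derive; auto; reflexivity|apply is_derive_sqrt_F|].
    intros; apply Rmult_comm.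
  + unfold plus, mult; simpl; ring.
Qed.

(** The product of all scale factors is a constant multiple of the lapse: direction 0 contributes
    one inverse [sqrt F_r], each block two factors [sqrt F_r], and the exponents [p_a] add up to
    1. *)
Lemma sum_scale_growth m A p tau :
  sum_n_m p 0 (2 * m) = 1 ->
  sum_n_m (fun a => scale_growth m A p a tau) 0 (2 * m) = lapse_growth m A p tau.
Proof.
rewrite !sum_n_m_even_split; intros hsum.
rewrite (sum_n_m_ext_loc _ (fun r => (p (2 * r - 1)%nat + p (2 * r)%nat) +
  2 * (chi p r * (1 - / F A p r tau)))).
- rewrite sum_n_m_Rplus, sum_n_m_Rscal; fold (block_growth m A p tau).
  unfold lapse_growth, scale_growth; lra.
- intros r hr; unfold scale_growth.
  destruct (2 * r - 1)%nat eqn:E1; [lia|]; destruct (2 * r)%nat eqn:E2; [lia|].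
  rewrite <- E1, <- E2, block_odd, block_even by lia; change_eq_R; ring.
Qed.

Lemma scale_factor_pos m A p a tau :
  (forall a, (a <= 2 * m)%nat -> 0 < A a) -> (a <= 2 * m)%nat ->
  0 < scale_factor m A p a tau.
Proof.
intros hA ha; pose proof (hA a ha) as hAa; destruct a as [|a]; unfold scale_factor;
  apply Rmult_lt_0_compat;
  try (apply Rmult_lt_0_compat; [exact hAa|apply exp_pos]).
- rewrite prod_1_inv; apply Rinv_0_lt_compat.
  pose proof (prod_sqrtF_ge_1 A p m tau); lra.
- apply sqrt_lt_R0, F_pos.
Qed.

(** * The inverse of proper time *)

Lemma tau_of_le m A p t tau :
  (forall r, (1 <= r <= m)%nat -> 0 < chi p r) -> 0 < t ->
  t <= proper_time m A p tau -> tau_of m A p t <= tau.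
Proof.
intros hchi ht h; apply Rnot_lt_le; intros hlt.
apply (proper_time_increasing m A p _ _ hchi) in hlt.
rewrite proper_time_tau_of in hlt; auto; lra.
Qed.

Lemma tau_of_ge m A p t tau :
  (forall r, (1 <= r <= m)%nat -> 0 < chi p r) -> 0 < t ->
  proper_time m A p tau <= t -> tau <= tau_of m A p t.
Proof.
intros hchi ht h; apply Rnot_lt_le; intros hlt.
apply (proper_time_increasing m A p _ _ hchi) in hlt.
rewrite proper_time_tau_of in hlt; auto; lra.
Qed.

(** Monotonicity traps the inverse: proper times between those of [x - eps / 2] and [x + eps / 2]
    have their [tau] in that interval, and [d] is the smaller of the two gaps to [t]. *)
Lemma continuous_tau_of m A p t :
  (forall r, (1 <= r <= m)%nat -> 0 < chi p r) -> 0 < t ->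
  continuity_pt (tau_of m A p) t.
Proof.
intros hchi ht; apply continuity_pt_filterlim, filterlim_locally; intros eps.
set (x := tau_of m A p t).
pose proof (cond_pos eps) as he.
assert (h1 := proper_time_increasing m A p (x - eps / 2) x hchi ltac:(lra)).
assert (h2 := proper_time_increasing m A p x (x + eps / 2) hchi ltac:(lra)).
assert (hx : proper_time m A p x = t) by (apply proper_time_tau_of; auto).
assert (h3 := proper_time_pos m A p (x - eps / 2) hchi).
set (d := Rmin (t - proper_time m A p (x - eps / 2))
               (proper_time m A p (x + eps / 2) - t)).
assert (hd : 0 < d) by (apply Rmin_pos; lra).
exists (mkposreal d hd); intros y hy.
apply Rabs_def2 in hy; unfold minus, plus, opp in hy; simpl in hy.
assert (d <= t - proper_time m A p (x - eps / 2)) by apply Rmin_l.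
assert (d <= proper_time m A p (x + eps / 2) - t) by apply Rmin_r.
assert (tau_of m A p y <= x + eps / 2) by (apply tau_of_le; auto; lra).
assert (x - eps / 2 <= tau_of m A p y) by (apply tau_of_ge; auto; lra).
apply Rabs_def1; unfold minus, plus, opp; simpl; lra.
Qed.

Lemma is_derive_tau_of m A p t :
  (forall r, (1 <= r <= m)%nat -> 0 < chi p r) -> 0 < t ->
  is_derive (tau_of m A p) t (/ lapse m A p (tau_of m A p t)).
Proof.
intros hchi ht; apply is_derive_Reals.
assert (hder : forall x, derivable_pt_lim (proper_time m A p) x (lapse m A p x)).
{ intros x; apply is_derive_Reals, is_derive_proper_time; auto. }
(* A transparent proof of differentiability, so that [derive_pt] computes to the lapse; [t / 2] and
   [2 * t] provide an interval around [t] inside the positive half-line. *)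
pose (Prf := fun (a : R) (_ : tau_of m A p (t / 2) <= a <= tau_of m A p (2 * t)) =>
  exist _ (lapse m A p a) (hder a) : derivable_pt (proper_time m A p) a).
assert (hg : tau_of m A p (t / 2) <= tau_of m A p t <= tau_of m A p (2 * t)).
{ split; [apply tau_of_le|apply tau_of_ge]; auto; try lra;
    rewrite !proper_time_tau_of; auto; lra. }
replace (/ lapse m A p (tau_of m A p t)) with
  (1 / derive_pt (proper_time m A p) (tau_of m A p t) (Prf _ hg))
  by (simpl; unfold Rdiv; ring).
apply derivable_pt_lim_recip_interv; try lra.
- apply continuous_tau_of; auto.
- intros x hx; unfold comp, id; apply proper_time_tau_of; auto; lra.
- simpl; pose proof (lapse_pos m A p (tau_of m A p t)); lra.
Qed.

Lemma is_derive_comp_tau_of m A p (f : R -> R) t df :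
  (forall r, (1 <= r <= m)%nat -> 0 < chi p r) -> 0 < t ->
  is_derive f (tau_of m A p t) df ->
  is_derive (fun x : R => f (tau_of m A p x)) t (df / lapse m A p (tau_of m A p t)).
Proof.
intros hchi ht hf; evar_last.
- apply (is_derive_comp f (tau_of m A p)); [exact hf|apply is_derive_tau_of; auto].
- unfold scal; simpl; unfold mult; simpl; unfold Rdiv; ring.
Qed.

(** * Exponential decay in [tau] *)

Definition bounded_fut (f : R -> R) : Prop :=
  exists M, forall tau, 0 <= tau -> Rabs (f tau) <= M.

Definition decays (b : R) (f : R -> R) : Prop :=
  exists C, forall tau, 0 <= tau -> Rabs (f tau) <= C * exp (- (b * tau)).

(* When [s] is the derivative of [tau] with respect to [ln t], the functions
   [f1] and [f2] are the first and second [t d/dt]-derivatives of [f]. *)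
Definition decays2 (s : R -> R) (b : R) (f : R -> R) : Prop :=
  exists f1 f2 : R -> R,
    (forall tau, is_derive f tau (f1 tau / s tau)) /\
    (forall tau, is_derive f1 tau (f2 tau / s tau)) /\
    decays b f /\ decays b f1 /\ decays b f2.

Lemma exp_neg_le_1 x : 0 <= x -> exp (- x) <= 1.
Proof.
intros [hx| <-]; rewrite <- exp_0.
- apply Rlt_le, exp_increasing; lra.
- rewrite Ropp_0; lra.
Qed.

Lemma exp_le x y : x <= y -> exp x <= exp y.
Proof. intros [h| ->]; [apply Rlt_le, exp_increasing; auto|lra]. Qed.

Lemma decays_ext b f g :
  (forall tau, f tau = g tau) -> decays b f -> decays b g.
Proof. intros hfg [C hC]; exists C; intros tau ht; rewrite <- hfg; auto. Qed.

Lemma decays_0 b : decays b (fun _ => 0).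
Proof. exists 0; intros; rewrite Rabs_R0; lra. Qed.

Lemma decays_plus b f g :
  decays b f -> decays b g -> decays b (fun x => f x + g x).
Proof.
intros [C hC] [C' hC']; exists (C + C'); intros tau ht.
eapply Rle_trans; [apply Rabs_triang|].
specialize (hC tau ht); specialize (hC' tau ht); lra.
Qed.

Lemma decays_mult b f g :
  bounded_fut g -> decays b f -> decays b (fun x => g x * f x).
Proof.
intros [M hM] [C hC]; exists (M * C); intros tau ht; rewrite Rabs_mult, Rmult_assoc.
apply Rmult_le_compat; auto using Rabs_pos.
Qed.

Lemma bounded_fut_const c : bounded_fut (fun _ => c).
Proof. exists (Rabs c); intros; lra. Qed.

Lemma bounded_fut_plus f g :
  bounded_fut f -> bounded_fut g -> bounded_fut (fun x => f x + g x).
Proof.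
intros [C hC] [C' hC']; exists (C + C'); intros tau ht.
eapply Rle_trans; [apply Rabs_triang|].
specialize (hC tau ht); specialize (hC' tau ht); lra.
Qed.

Lemma bounded_fut_mult f g :
  bounded_fut f -> bounded_fut g -> bounded_fut (fun x => f x * g x).
Proof.
intros [M hM] [C hC]; exists (M * C); intros tau ht; rewrite Rabs_mult.
apply Rmult_le_compat; auto using Rabs_pos.
Qed.

Lemma decays_bounded b f : 0 <= b -> decays b f -> bounded_fut f.
Proof.
intros hb [C hC]; exists C; intros tau ht; specialize (hC tau ht).
assert (hbt : 0 <= b * tau) by nra.
pose proof (exp_neg_le_1 _ hbt); pose proof (exp_pos (- (b * tau))).
pose proof (Rabs_pos (f tau)).
assert (0 <= C) by nra; nra.
Qed.

Lemma decays_sum b (f : nat -> R -> R) m :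
  (forall r, (1 <= r <= m)%nat -> decays b (f r)) ->
  decays b (fun x => sum_n_m (fun r => f r x) 1 m).
Proof.
intros hf; induction m as [|m IH].
- apply decays_ext with (fun _ => 0); [|apply decays_0].
  intros x; rewrite sum_n_m_zero by lia; reflexivity.
- apply decays_ext with (fun x => sum_n_m (fun r => f r x) 1 m + f (S m) x).
  { intros x; rewrite sum_n_Sm by lia; reflexivity. }
  apply decays_plus; [apply IH; intros; apply hf; lia|apply hf; lia].
Qed.

Lemma bounded_fut_exp f : bounded_fut f -> bounded_fut (fun x => exp (f x)).
Proof.
intros [M hM]; exists (exp M); intros tau ht.
rewrite (Rabs_pos_eq (exp _)) by apply Rlt_le, exp_pos.
apply exp_le; eapply Rle_trans; [apply Rle_abs|auto].
Qed.

(** Both signs come from [1 + y <= exp y]: taken at [- x] and multiplied by [exp x] it settles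
    [x >= 0]; taken at [x] it settles [x < 0], where [exp (- x) >= 1]. *)
Lemma exp_m1_bound x : Rabs (exp x - 1) <= exp (Rabs x) * Rabs x.
Proof.
pose proof (exp_pos x) as h0; pose proof (exp_ineq1_le x) as h1.
destruct (Rle_dec 0 x) as [hx|hx].
- rewrite (Rabs_pos_eq x), (Rabs_pos_eq (exp x - 1)) by lra.
  pose proof (exp_ineq1_le (- x)) as h2.
  assert (exp x * exp (- x) = 1) by (rewrite exp_Ropp; field; lra); nra.
- rewrite (Rabs_left x) by lra.
  assert (exp x < 1) by (rewrite <- exp_0; apply exp_increasing; lra).
  rewrite Rabs_left by lra.
  pose proof (exp_ineq1_le (- x)); nra.
Qed.

(** A decaying [f] is bounded by some [M], and then [|exp f - 1| <= exp M * |f|]. *)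
Lemma decays_exp_m1 b f : 0 <= b -> decays b f -> decays b (fun x => exp (f x) - 1).
Proof.
intros hb hf; pose proof (decays_bounded b f hb hf) as [M hM].
assert (hd : decays b (fun x => exp M * f x))
  by (apply (decays_mult b f (fun _ => exp M)); auto using bounded_fut_const).
destruct hd as [C hC]; exists C; intros tau ht.
eapply Rle_trans; [apply exp_m1_bound|]; eapply Rle_trans; [|apply hC; auto].
rewrite Rabs_mult, (Rabs_pos_eq (exp M)) by apply Rlt_le, exp_pos.
apply Rmult_le_compat_r; [apply Rabs_pos|apply exp_le; auto].
Qed.

(** * Decay together with two derivatives *)

Lemma decays2_ext s b f g :
  (forall tau, f tau = g tau) -> decays2 s b f -> decays2 s b g.
Proof.
intros hfg (f1 & f2 & d1 & d2 & b0 & b1 & b2); exists f1, f2.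
refine (conj _ (conj _ (conj _ (conj _ _)))); auto.
- intros tau; apply is_derive_ext with f; auto.
- apply decays_ext with f; auto.
Qed.

Lemma decays2_0 s b : decays2 s b (fun _ => 0).
Proof.
exists (fun _ => 0), (fun _ => 0).
refine (conj _ (conj _ (conj _ (conj _ _)))); auto using decays_0;
  intros tau; unfold Rdiv; rewrite Rmult_0_l; apply @is_derive_const.
Qed.

Lemma decays2_plus s b f g :
  decays2 s b f -> decays2 s b g -> decays2 s b (fun x => f x + g x).
Proof.
intros (f1 & f2 & d1 & d2 & b0 & b1 & b2) (g1 & g2 & e1 & e2 & c0 & c1 & c2).
exists (fun x => f1 x + g1 x), (fun x => f2 x + g2 x).
refine (conj _ (conj _ (conj _ (conj _ _)))); auto using decays_plus;
  intros tau; rewrite Rdiv_plus_distr;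
  [apply (is_derive_plus f g)|apply (is_derive_plus f1 g1)]; auto.
Qed.

Lemma decays2_scal s b c f : decays2 s b f -> decays2 s b (fun x => c * f x).
Proof.
intros (f1 & f2 & d1 & d2 & b0 & b1 & b2).
exists (fun x => c * f1 x), (fun x => c * f2 x).
refine (conj _ (conj _ (conj _ (conj _ _))));
  try (apply (decays_mult b _ (fun _ => c)); auto using bounded_fut_const);
  intros tau; unfold Rdiv; rewrite Rmult_assoc; apply is_derive_scal; auto.
Qed.

Lemma decays2_sum s b (f : nat -> R -> R) m :
  (forall r, (1 <= r <= m)%nat -> decays2 s b (f r)) ->
  decays2 s b (fun x => sum_n_m (fun r => f r x) 1 m).
Proof.
intros hf; induction m as [|m IH].
- apply decays2_ext with (fun _ => 0); [|apply decays2_0].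
  intros x; rewrite sum_n_m_zero by lia; reflexivity.
- apply decays2_ext with (fun x => sum_n_m (fun r => f r x) 1 m + f (S m) x).
  { intros x; rewrite sum_n_Sm by lia; reflexivity. }
  apply decays2_plus; [apply IH; intros; apply hf; lia|apply hf; lia].
Qed.

(** The successive derivatives are [exp f * f1] and [exp f * (f1 ^ 2 + f2)]; [b >= 0] makes [exp f]
    and [f1] bounded, so each term is a bounded factor times a decaying one. *)
Lemma decays2_exp_m1 s b f :
  0 <= b -> decays2 s b f -> decays2 s b (fun x => exp (f x) - 1).
Proof.
intros hb (f1 & f2 & d1 & d2 & b0 & b1 & b2).
assert (hexp : forall tau,
  is_derive (fun x => exp (f x)) tau (exp (f tau) * (f1 tau / s tau))).
{ intros tau; evar_last.
  - apply (is_derive_comp exp f); [apply is_derive_Reals, derivable_pt_lim_exp|apply d1].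
  - unfold scal; simpl; unfold mult; simpl; ring. }
pose proof (bounded_fut_exp f (decays_bounded b f hb b0)) as hbe.
exists (fun x => exp (f x) * f1 x), (fun x => exp (f x) * (f1 x * f1 x + f2 x)).
refine (conj _ (conj _ (conj _ (conj _ _)))).
- intros tau; evar_last.
  + apply (is_derive_minus (fun x => exp (f x)) (fun _ => 1));
      [apply hexp|apply @is_derive_const].
  + unfold minus, plus, opp, zero; simpl; unfold Rdiv; ring.
- intros tau; evar_last.
  + apply (is_derive_mult (fun x => exp (f x)) f1); [apply hexp|apply d2|].
    intros; apply Rmult_comm.
  + unfold plus, mult; simpl; unfold Rdiv; ring.
- apply decays_exp_m1; auto.
- apply decays_mult; auto.
- apply (decays_mult b (fun x => f1 x * f1 x + f2 x)); auto.
  apply decays_plus; auto; apply decays_mult; auto; apply decays_bounded with b; auto.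
Qed.

Lemma nondecr_of_derive (f df : R -> R) a b :
  a <= b -> (forall x, a <= x <= b -> is_derive f x (df x)) ->
  (forall x, a <= x <= b -> 0 <= df x) -> f a <= f b.
Proof.
intros hab hd h0.
destruct (MVT_gen f a b df) as [c [hc he]].
- intros x; rewrite Rmin_left, Rmax_right by auto; intros; apply hd; lra.
- intros x; rewrite Rmin_left, Rmax_right by auto; intros.
  apply continuity_pt_filterlim, (ex_derive_continuous f); eexists; apply hd; lra.
- rewrite Rmin_left, Rmax_right in hc by auto.
  specialize (h0 c hc); nra.
Qed.

(** * Late-time asymptotics of the lapse and of proper time *)

(** The logarithm of the relative correction in [F_r = k_r * exp (2 chi_r tau) * (1 + exp (- 2 chi_r
    tau) / k_r)], with [k_r] the coefficient [Fcoef]. *)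
Definition log_F_excess (A p : nat -> R) (r : nat) (tau : R) : R :=
  ln (1 + exp (- (2 * chi p r * tau)) / Fcoef A p r).

Lemma log_F_excess_arg_gt_1 A p r tau :
  0 < Fcoef A p r -> 1 < 1 + exp (- (2 * chi p r * tau)) / Fcoef A p r.
Proof.
intros hk; assert (0 < exp (- (2 * chi p r * tau)) / Fcoef A p r); [|lra].
apply Rdiv_lt_0_compat; auto using exp_pos.
Qed.

Lemma sqrt_F_eq A p r tau :
  0 < Fcoef A p r ->
  sqrt (F A p r tau) =
  sqrt (Fcoef A p r) * exp (chi p r * tau) * exp (log_F_excess A p r tau / 2).
Proof.
intros hk; pose proof (log_F_excess_arg_gt_1 A p r tau hk) as h1.
apply sqrt_lem_1.
- apply Rlt_le, F_pos.
- apply Rlt_le; repeat apply Rmult_lt_0_compat; auto using exp_pos, sqrt_lt_R0.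
- set (l := log_F_excess A p r tau).
  transitivity ((sqrt (Fcoef A p r) * sqrt (Fcoef A p r)) *
    (exp (chi p r * tau) * exp (chi p r * tau)) * (exp (l / 2) * exp (l / 2))); [ring|].
  rewrite sqrt_sqrt, <- !exp_plus by lra.
  replace (l / 2 + l / 2) with l by field; unfold l, log_F_excess.
  rewrite exp_ln by lra; rewrite exp_Ropp.
  unfold F; fold (Fcoef A p r).
  replace (chi p r * tau + chi p r * tau) with (2 * chi p r * tau) by ring.
  pose proof (exp_pos (2 * chi p r * tau)); field; lra.
Qed.

(** Up to a constant the function is [ln F_r - 2 chi_r tau], and
    [F_r' / F_r = 2 chi_r (1 - 1 / F_r)]. *)
Lemma is_derive_log_F_excess A p r tau :
  0 < Fcoef A p r ->
  is_derive (log_F_excess A p r) tau (- 2 * chi p r / F A p r tau).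
Proof.
intros hk; pose proof (log_F_excess_arg_gt_1 A p r tau hk) as h1.
unfold log_F_excess, F; fold (Fcoef A p r); auto_derive; [lra|].
rewrite exp_Ropp in *.
pose proof (exp_pos (2 * chi p r * tau)) as he.
assert (0 < Fcoef A p r * exp (2 * chi p r * tau)) by nra.
field; repeat split; lra.
Qed.

(** From [0 <= ln (1 + x) <= x] with [x = exp (- 2 chi_r tau) / k_r]; for [tau >= 0] the exponential
    does not decrease when [2 chi_r] is lowered to [b]. *)
Lemma decays_log_F_excess A p r b :
  0 < Fcoef A p r -> b <= 2 * chi p r -> decays b (log_F_excess A p r).
Proof.
intros hk hb; exists (/ Fcoef A p r); intros tau ht.
pose proof (log_F_excess_arg_gt_1 A p r tau hk) as h1; unfold log_F_excess.
set (x := exp (- (2 * chi p r * tau)) / Fcoef A p r) in *.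
assert (h0 : 0 <= ln (1 + x)) by (rewrite <- ln_1; apply ln_le; lra).
rewrite Rabs_pos_eq by auto.
apply Rle_trans with x.
- rewrite <- (ln_exp x) at 2; apply ln_le; [lra|apply exp_ineq1_le].
- unfold x, Rdiv; rewrite Rmult_comm; apply Rmult_le_compat_l.
  + apply Rlt_le, Rinv_0_lt_compat; auto.
  + apply exp_le; nra.
Qed.

(** [F_r] is at least [k_r * exp (2 chi_r tau)], hence at least [k_r * exp (b tau)] for
    [tau >= 0]. *)
Lemma decays_inv_F A p r b :
  0 < Fcoef A p r -> b <= 2 * chi p r -> decays b (fun tau => / F A p r tau).
Proof.
intros hk hb; exists (/ Fcoef A p r); intros tau ht.
pose proof (F_pos A p r tau) as hF.
rewrite Rabs_pos_eq by (apply Rlt_le, Rinv_0_lt_compat; auto).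
rewrite exp_Ropp, <- Rinv_mult; apply Rinv_le_contravar.
- apply Rmult_lt_0_compat; auto using exp_pos.
- unfold F; fold (Fcoef A p r).
  assert (exp (b * tau) <= exp (2 * chi p r * tau)) by (apply exp_le; nra).
  nra.
Qed.

(** The constant [c] in the late behaviour [c * exp (D tau)] of the lapse. *)
Definition lapse_coef (m : nat) (A p : nat -> R) : R :=
  prod_1 (fun r => sqrt (Fcoef A p r)) m.

Definition log_lapse_excess (m : nat) (A p : nat -> R) (tau : R) : R :=
  sum_n_m (fun r => log_F_excess A p r tau) 1 m / 2.

Lemma prod_sqrt_F_eq m A p tau :
  (forall r, (1 <= r <= m)%nat -> 0 < Fcoef A p r) ->
  prod_1 (fun r => sqrt (F A p r tau)) m =
  lapse_coef m A p * exp (sum_n_m (chi p) 1 m * tau) *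
  exp (log_lapse_excess m A p tau).
Proof.
unfold lapse_coef, log_lapse_excess; intros hk; induction m as [|m IH].
- rewrite !sum_n_m_zero by lia; unfold zero; simpl.
  unfold Rdiv; rewrite !Rmult_0_l, exp_0; ring.
- rewrite !sum_n_Sm by lia; unfold plus; simpl.
  rewrite IH by (intros; apply hk; lia).
  rewrite sqrt_F_eq by (apply hk; lia).
  rewrite Rdiv_plus_distr, Rmult_plus_distr_r, !exp_plus; ring.
Qed.

Lemma lapse_eq m A p tau :
  (forall r, (1 <= r <= m)%nat -> 0 < Fcoef A p r) ->
  lapse m A p tau =
  lapse_coef m A p * exp (Dsum m p * tau) * exp (log_lapse_excess m A p tau).
Proof.
intros hk; unfold lapse, Dsum; rewrite prod_sqrt_F_eq by auto.
rewrite Rmult_plus_distr_r, Rmult_1_l, exp_plus; ring.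
Qed.

Lemma lapse_coef_pos m A p :
  (forall r, (1 <= r <= m)%nat -> 0 < Fcoef A p r) -> 0 < lapse_coef m A p.
Proof. intros hk; apply prod_1_pos; intros; apply sqrt_lt_R0; auto. Qed.

Definition growth_defect (m : nat) (A p : nat -> R) (tau : R) : R :=
  sum_n_m (fun r => chi p r * / F A p r tau) 1 m.

Lemma growth_defect_eq m A p tau :
  growth_defect m A p tau = Dsum m p - lapse_growth m A p tau.
Proof.
unfold growth_defect, Dsum, lapse_growth, block_growth.
rewrite (sum_n_m_ext (fun r => chi p r * / F A p r tau)
  (fun r => chi p r + - 1 * (chi p r * (1 - / F A p r tau)))) by (intros; change_eq_R; ring).
rewrite sum_n_m_Rplus, sum_n_m_Rscal; change_eq_R; ring.
Qed.

Lemma growth_defect_nonneg m A p tau :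
  (forall r, (1 <= r <= m)%nat -> 0 < chi p r) -> 0 <= growth_defect m A p tau.
Proof.
intros hchi; apply sum_1_nonneg; intros r hr.
apply Rmult_le_pos; [apply Rlt_le; auto|apply Rlt_le, Rinv_0_lt_compat, F_pos].
Qed.

Lemma lapse_growth_ge_1 m A p tau :
  (forall r, (1 <= r <= m)%nat -> 0 < chi p r) -> 1 <= lapse_growth m A p tau.
Proof.
intros hchi; unfold lapse_growth.
assert (0 <= block_growth m A p tau); [|lra].
apply sum_1_nonneg; intros r hr; apply Rmult_le_pos; [apply Rlt_le; auto|].
pose proof (F_ge_1 A p r tau); rewrite <- Rinv_1.
assert (/ F A p r tau <= / 1) by (apply Rinv_le_contravar; lra); lra.
Qed.

Lemma decays_growth_defect m A p b :
  (forall r, (1 <= r <= m)%nat -> 0 < Fcoef A p r) ->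
  (forall r, (1 <= r <= m)%nat -> b <= 2 * chi p r) ->
  decays b (growth_defect m A p).
Proof.
intros hk hb; apply (decays_sum b (fun r tau => chi p r * / F A p r tau)).
intros r hr; apply (decays_mult b (fun tau => / F A p r tau) (fun _ => chi p r)).
- apply bounded_fut_const.
- apply decays_inv_F; auto.
Qed.

Lemma decays_log_lapse_excess m A p b :
  (forall r, (1 <= r <= m)%nat -> 0 < Fcoef A p r) ->
  (forall r, (1 <= r <= m)%nat -> b <= 2 * chi p r) ->
  decays b (log_lapse_excess m A p).
Proof.
intros hk hb.
apply decays_ext with
  (fun tau => / 2 * sum_n_m (fun r => log_F_excess A p r tau) 1 m).
{ intros; unfold log_lapse_excess, Rdiv; apply Rmult_comm. }
apply (decays_mult b _ (fun _ => / 2)); [apply bounded_fut_const|].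
apply decays_sum; intros r hr; apply decays_log_F_excess; auto.
Qed.

Lemma log_lapse_excess_nonneg m A p tau :
  (forall r, (1 <= r <= m)%nat -> 0 < Fcoef A p r) -> 0 <= log_lapse_excess m A p tau.
Proof.
intros hk; unfold log_lapse_excess.
assert (0 <= sum_n_m (fun r => log_F_excess A p r tau) 1 m); [|lra].
apply sum_1_nonneg; intros r hr; unfold log_F_excess.
pose proof (log_F_excess_arg_gt_1 A p r tau (hk r hr)).
rewrite <- ln_1; apply ln_le; lra.
Qed.

Lemma lapse_bounds m A p :
  (forall r, (1 <= r <= m)%nat -> 0 < Fcoef A p r) ->
  (forall r, (1 <= r <= m)%nat -> 0 < chi p r) ->
  exists C, forall tau, 0 <= tau ->
    lapse_coef m A p * exp (Dsum m p * tau) <= lapse m A p tau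
      <= C * exp (Dsum m p * tau).
Proof.
intros hk hchi.
(* Rate 0 serves only to extract a bound; as the excess is nonnegative, the lower constant is
   [lapse_coef] itself. *)
destruct (decays_bounded 0 _ (Rle_refl 0) (decays_log_lapse_excess m A p 0 hk ltac:(
  intros r hr; specialize (hchi r hr); lra))) as [M hM].
exists (lapse_coef m A p * exp M); intros tau ht; rewrite lapse_eq by auto.
pose proof (lapse_coef_pos m A p hk) as hc; pose proof (exp_pos (Dsum m p * tau)) as he.
pose proof (log_lapse_excess_nonneg m A p tau hk) as h0.
apply exp_le in h0; rewrite exp_0 in h0.
specialize (hM tau ht); rewrite Rabs_pos_eq in hM by (apply log_lapse_excess_nonneg; auto).
apply exp_le in hM.
assert (0 < lapse_coef m A p * exp (Dsum m p * tau)) by nra.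
split; nra.
Qed.

(** The quantity [s] of the overview. As [dt / dtau = N], it is also the derivative of [tau] with
    respect to [ln t], the role of [s] in [decays2]. *)
Definition time_ratio (m : nat) (A p : nat -> R) (tau : R) : R :=
  proper_time m A p tau / lapse m A p tau.

Lemma is_derive_time_ratio m A p tau :
  (forall r, (1 <= r <= m)%nat -> 0 < chi p r) ->
  is_derive (time_ratio m A p) tau
    (1 - time_ratio m A p tau * lapse_growth m A p tau).
Proof.
intros hchi; pose proof (lapse_pos m A p tau); evar_last.
- apply (is_derive_div (proper_time m A p) (lapse m A p));
    [apply is_derive_proper_time; auto|apply is_derive_lapse|lra].
- unfold time_ratio; simpl; field; lra.
Qed.

Lemma is_derive_lapse_lag m A p tau :
  (forall r, (1 <= r <= m)%nat -> 0 < chi p r) ->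
  is_derive (fun x => proper_time m A p x - / Dsum m p * lapse m A p x) tau
    (lapse m A p tau * growth_defect m A p tau / Dsum m p).
Proof.
intros hchi; pose proof (Dsum_ge_1 m p hchi); evar_last.
- apply (is_derive_minus (proper_time m A p) (fun x => / Dsum m p * lapse m A p x));
    [apply is_derive_proper_time; auto|apply is_derive_scal, is_derive_lapse].
- rewrite growth_defect_eq; unfold minus, plus, opp; simpl; field; lra.
Qed.

Lemma lapse_lag_incr m A p x y :
  (forall r, (1 <= r <= m)%nat -> 0 < chi p r) -> x <= y ->
  proper_time m A p x - / Dsum m p * lapse m A p x <=
  proper_time m A p y - / Dsum m p * lapse m A p y.
Proof.
intros hchi hxy; pose proof (Dsum_ge_1 m p hchi) as hD.
apply (nondecr_of_derive (fun x => proper_time m A p x - / Dsum m p * lapse m A p x)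
  (fun tau => lapse m A p tau * growth_defect m A p tau / Dsum m p)); auto.
- intros; apply is_derive_lapse_lag; auto.
- intros z _; pose proof (growth_defect_nonneg m A p z hchi).
  pose proof (lapse_pos m A p z).
  apply Rmult_le_pos; [nra|apply Rlt_le, Rinv_0_lt_compat; lra].
Qed.

(** The upper bound is [t <= N], from the monotone product in the lapse. The lower one integrates
    [N' <= D * N] from [-oo], that is, shows the lag [t - N / D] to be nonnegative. *)
Lemma time_ratio_bounds m A p tau :
  (forall r, (1 <= r <= m)%nat -> 0 < chi p r) ->
  / Dsum m p <= time_ratio m A p tau <= 1.
Proof.
intros hchi; pose proof (Dsum_ge_1 m p hchi) as hD.
pose proof (lapse_pos m A p tau) as hN.
unfold time_ratio; split.
- set (y := proper_time m A p tau - / Dsum m p * lapse m A p tau).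
  assert (hy : 0 <= y).
  (* The lag increases in [tau], and its negative part is at most [N / D],
     which tends to 0 at [-oo]. *)
  { apply Rnot_lt_le; intros hy.
    set (K := prod_1 (fun r => sqrt (F A p r tau)) m).
    assert (hK : 1 <= K) by apply prod_sqrtF_ge_1.
    (* At such an [x] the lapse is at most [- y / 2], so the lag there exceeds [y / 2]; as [y < 0],
       this contradicts its being at most [y]. *)
    set (x := Rmin tau (ln (- y / (2 * K)))).
    assert (hyK : 0 < - y / (2 * K)) by (apply Rdiv_lt_0_compat; lra).
    assert (hx1 : x <= tau) by apply Rmin_l.
    assert (hx2 : x <= ln (- y / (2 * K))) by apply Rmin_r.
    pose proof (lapse_lag_incr m A p x tau hchi hx1) as hi; fold y in hi.
    pose proof (proper_time_pos m A p x hchi).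
    apply exp_le in hx2; rewrite exp_ln in hx2 by auto.
    pose proof (prod_sqrtF_incr A p m x tau hchi hx1) as hp; fold K in hp.
    pose proof (exp_pos x) as hex.
    assert (hNx : lapse m A p x <= - y / 2).
    { unfold lapse; apply Rle_trans with (- y / (2 * K) * K); [|right; field; lra].
      pose proof (prod_sqrtF_ge_1 A p m x).
      apply Rmult_le_compat; lra. }
    assert (/ Dsum m p <= 1) by (rewrite <- Rinv_1; apply Rinv_le_contravar; lra).
    assert (0 < / Dsum m p) by (apply Rinv_0_lt_compat; lra).
    pose proof (lapse_pos m A p x).
    assert (/ Dsum m p * lapse m A p x <= lapse m A p x) by nra.
    lra. }
  apply (Rmult_le_reg_r (lapse m A p tau)); auto.
  unfold y in hy; unfold Rdiv; rewrite Rmult_assoc, Rinv_l by lra; lra.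
- apply (Rmult_le_reg_r (lapse m A p tau)); auto.
  unfold Rdiv; rewrite Rmult_assoc, Rinv_l by lra.
  pose proof (proper_time_bounds m A p tau hchi); unfold lapse; lra.
Qed.

Lemma time_ratio_pos m A p tau :
  (forall r, (1 <= r <= m)%nat -> 0 < chi p r) -> 0 < time_ratio m A p tau.
Proof.
intros hchi; apply Rdiv_lt_0_compat; [apply proper_time_pos; auto|apply lapse_pos].
Qed.

Lemma decays_time_ratio m A p b :
  (forall r, (1 <= r <= m)%nat -> 0 < Fcoef A p r) ->
  (forall r, (1 <= r <= m)%nat -> 0 < chi p r) ->
  (forall r, (1 <= r <= m)%nat -> b <= 2 * chi p r) ->
  b < Dsum m p ->
  decays b (fun tau => 1 - Dsum m p * time_ratio m A p tau).
Proof.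
intros hk hchi hb hbD.
pose proof (Dsum_ge_1 m p hchi) as hD.
pose proof (lapse_coef_pos m A p hk) as hc.
destruct (lapse_bounds m A p hk hchi) as [C hC].
destruct (decays_growth_defect m A p b hk hb) as [C' hC'].
set (D := Dsum m p) in *; set (c := lapse_coef m A p) in *.
set (y := fun x => proper_time m A p x - / D * lapse m A p x).
(* The lag has derivative at most [(C C' / D) exp ((D - b) tau)]; [K] is the coefficient of the
   antiderivative. *)
set (K := C * C' / D / (D - b)).
assert (hlag : forall tau, 0 <= tau -> y tau <= y 0 - K + K * exp ((D - b) * tau)).
{ intros tau ht.
  cut (K * exp ((D - b) * 0) - y 0 <= K * exp ((D - b) * tau) - y tau).
  { rewrite Rmult_0_r, exp_0; lra. }
  apply (nondecr_of_derive (fun x => K * exp ((D - b) * x) - y x)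
    (fun x => C * C' / D * exp ((D - b) * x)
              - lapse m A p x * growth_defect m A p x / D)); auto.
  - intros x _; evar_last.
    + apply (is_derive_minus (fun x => K * exp ((D - b) * x)) y);
        [auto_derive; auto; reflexivity|apply is_derive_lapse_lag; auto].
    + unfold minus, plus, opp; simpl; fold D; unfold K; field; lra.
  - intros x hx.
    specialize (hC x ltac:(lra)) as [_ hu]; specialize (hC' x ltac:(lra)).
    pose proof (growth_defect_nonneg m A p x hchi) as hg.
    rewrite Rabs_pos_eq in hC' by auto.
    replace ((D - b) * x) with (D * x + - (b * x)) by ring; rewrite exp_plus.
    pose proof (lapse_pos m A p x).
    assert (lapse m A p x * growth_defect m A p x <=
      (C * exp (D * x)) * (C' * exp (- (b * x)))) by (apply Rmult_le_compat; lra).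
    replace (C * C' / D * (exp (D * x) * exp (- (b * x)))) with
      ((C * exp (D * x)) * (C' * exp (- (b * x))) / D) by (field; lra).
    assert (0 < / D) by (apply Rinv_0_lt_compat; lra).
    unfold Rdiv; nra. }
(* Here [|y 0| + 2 |K|] bounds the lag in units of [exp ((D - b) tau)], [c] comes from
   [c * exp (D tau) <= N], and [D] from [D s - 1 = D * lag / N]. *)
exists (D * ((Rabs (y 0) + Rabs K + Rabs K) / c)); intros tau ht.
pose proof (time_ratio_bounds m A p tau hchi) as [hs _]; fold D in hs.
pose proof (lapse_pos m A p tau) as hN.
assert (hDs : 1 <= D * time_ratio m A p tau).
{ rewrite <- (Rinv_r D) by lra; apply Rmult_le_compat_l; lra. }
rewrite Rabs_minus_sym, Rabs_pos_eq by lra.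
assert (hyt : D * time_ratio m A p tau - 1 = D * (y tau / lapse m A p tau)).
{ unfold y, time_ratio; field; lra. }
rewrite hyt, Rmult_assoc; apply Rmult_le_compat_l; [lra|].
apply (Rmult_le_reg_r (lapse m A p tau)); auto.
unfold Rdiv at 1; rewrite Rmult_assoc, Rinv_l, Rmult_1_r by lra.
set (M := Rabs (y 0) + Rabs K + Rabs K).
assert (hM : y tau <= M * exp ((D - b) * tau)).
{ specialize (hlag tau ht).
  (* As [b < D], the exponential is at least 1 and absorbs the constant [y 0 - K]. *)
  assert (1 <= exp ((D - b) * tau)) by (rewrite <- exp_0; apply exp_le; nra).
  pose proof (Rle_abs (y 0)); pose proof (Rabs_pos (y 0)).
  pose proof (Rle_abs K); pose proof (Rle_abs (- K)) as hK; rewrite Rabs_Ropp in hK.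
  pose proof (Rabs_pos K).
  unfold M; nra. }
eapply Rle_trans; [exact hM|].
destruct (hC tau ht) as [hl _].
replace (M * exp ((D - b) * tau)) with
  (M / c * exp (- (b * tau)) * (c * exp (D * tau))).
2:{ replace ((D - b) * tau) with (D * tau + - (b * tau)) by ring.
    rewrite exp_plus; field; lra. }
apply Rmult_le_compat_l; auto.
apply Rmult_le_pos; [|apply Rlt_le, exp_pos].
apply Rmult_le_pos; [|apply Rlt_le, Rinv_0_lt_compat; auto].
unfold M; pose proof (Rabs_pos (y 0)); pose proof (Rabs_pos K); lra.
Qed.

Lemma bounded_time_ratio m A p :
  (forall r, (1 <= r <= m)%nat -> 0 < chi p r) -> bounded_fut (time_ratio m A p).
Proof.
intros hchi; exists 1; intros tau _.
pose proof (time_ratio_pos m A p tau hchi); pose proof (time_ratio_bounds m A p tau hchi).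
rewrite Rabs_pos_eq; lra.
Qed.

Lemma bounded_time_ratio_derive m A p :
  (forall r, (1 <= r <= m)%nat -> 0 < chi p r) ->
  bounded_fut (fun tau => 1 - time_ratio m A p tau * lapse_growth m A p tau).
Proof.
intros hchi; exists (1 + Dsum m p); intros tau _.
pose proof (time_ratio_pos m A p tau hchi); pose proof (time_ratio_bounds m A p tau hchi).
pose proof (lapse_growth_ge_1 m A p tau hchi); pose proof (Dsum_ge_1 m p hchi).
pose proof (growth_defect_nonneg m A p tau hchi) as hg; rewrite growth_defect_eq in hg.
apply Rabs_le; nra.
Qed.

(** * Logarithmic corrections with two derivatives in [ln t] *)

Lemma decays2_log_F_excess m A p r b :
  (forall r, (1 <= r <= m)%nat -> 0 < chi p r) ->
  0 <= b <= 2 * chi p r -> 0 < Fcoef A p r ->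
  decays2 (time_ratio m A p) b (log_F_excess A p r).
Proof.
intros hchi hb hk.
assert (hinv : decays b (fun tau => / F A p r tau)) by (apply decays_inv_F; lra).
pose proof (bounded_time_ratio m A p hchi) as hs.
assert (hs1 : decays b (fun tau => (- 2 * chi p r) * (time_ratio m A p tau * / F A p r tau))).
{ apply (decays_mult b _ (fun _ => - 2 * chi p r)); [apply bounded_fut_const|].
  apply decays_mult; auto. }
exists (fun tau => (- 2 * chi p r) * (time_ratio m A p tau * / F A p r tau)).
(* This is [s] times the derivative of the first witness, by [s' = 1 - s h] and
   [(1 / F)' = - 2 chi_r (1 / F) (1 - 1 / F)], grouped as a bounded factor times a multiple of
   [1 / F]. *)
exists (fun tau =>
  (time_ratio m A p tau *
   ((1 - time_ratio m A p tau * lapse_growth m A p tau) +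
    (- 2 * chi p r) * (time_ratio m A p tau * (1 + - 1 * / F A p r tau)))) *
  ((- 2 * chi p r) * / F A p r tau)).
refine (conj _ (conj _ (conj _ (conj _ _)))); auto.
- intros tau; pose proof (time_ratio_pos m A p tau hchi); pose proof (F_pos A p r tau).
  evar_last; [apply is_derive_log_F_excess; auto|field; lra].
- intros tau; pose proof (time_ratio_pos m A p tau hchi); pose proof (F_pos A p r tau).
  evar_last.
  + apply is_derive_scal.
    apply (is_derive_mult (time_ratio m A p) (fun x => / F A p r x)).
    * apply is_derive_time_ratio; auto.
    * apply is_derive_inv; [apply is_derive_F|lra].
    * intros; apply Rmult_comm.
  + unfold plus, mult; simpl; field; lra.
- apply decays_log_F_excess; lra.
- apply (decays_mult b (fun tau => (- 2 * chi p r) * / F A p r tau)).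
  + apply bounded_fut_mult; auto; apply bounded_fut_plus.
    * apply bounded_time_ratio_derive; auto.
    * apply bounded_fut_mult; [apply bounded_fut_const|].
      apply bounded_fut_mult; auto.
      apply bounded_fut_plus; [apply bounded_fut_const|].
      apply bounded_fut_mult; [apply bounded_fut_const|].
      apply decays_bounded with b; auto; lra.
  + apply (decays_mult b _ (fun _ => - 2 * chi p r)); auto using bounded_fut_const.
Qed.

(* The leading behaviour is [t = (c / D) exp (D tau)], as [N = c exp (D tau)]. *)
Definition log_time_excess (m : nat) (A p : nat -> R) (tau : R) : R :=
  ln (proper_time m A p tau) - Dsum m p * tau - ln (lapse_coef m A p / Dsum m p).

(** Since [t = s * N], one has [ln t = ln s + ln N], and [ln N] is [ln c + D tau] plus its excess.
    The definition suits differentiation, this form suits the decay estimate. *)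
Lemma log_time_excess_eq m A p tau :
  (forall r, (1 <= r <= m)%nat -> 0 < Fcoef A p r) ->
  (forall r, (1 <= r <= m)%nat -> 0 < chi p r) ->
  log_time_excess m A p tau =
  ln (Dsum m p * time_ratio m A p tau) + log_lapse_excess m A p tau.
Proof.
intros hk hchi; pose proof (Dsum_ge_1 m p hchi) as hD.
pose proof (lapse_coef_pos m A p hk) as hc; pose proof (lapse_pos m A p tau) as hN.
pose proof (proper_time_pos m A p tau hchi) as hT.
assert (hlog : ln (lapse m A p tau) =
  ln (lapse_coef m A p) + Dsum m p * tau + log_lapse_excess m A p tau).
{ rewrite lapse_eq by auto.
  rewrite !ln_mult by (try apply Rmult_lt_0_compat; auto using exp_pos).
  rewrite !ln_exp; auto. }
unfold log_time_excess, time_ratio.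
rewrite ln_mult, !ln_div by (try apply Rdiv_lt_0_compat; lra).
rewrite hlog; ring.
Qed.

(** The [t d/dt]-derivatives are [1 - D s] and [- D s (1 - s h)], where
    [1 - s h = (1 - D s) + s (D - h)] and both terms decay. *)
Lemma decays2_log_time_excess m A p b :
  (forall r, (1 <= r <= m)%nat -> 0 < Fcoef A p r) ->
  (forall r, (1 <= r <= m)%nat -> 0 < chi p r) ->
  (forall r, (1 <= r <= m)%nat -> b <= 2 * chi p r) ->
  0 <= b < Dsum m p ->
  decays2 (time_ratio m A p) b (log_time_excess m A p).
Proof.
intros hk hchi hb hbD; pose proof (Dsum_ge_1 m p hchi) as hD.
assert (hr : decays b (fun tau => 1 - Dsum m p * time_ratio m A p tau))
  by (apply decays_time_ratio; auto; lra).
pose proof (bounded_time_ratio m A p hchi) as hs.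
exists (fun tau => 1 - Dsum m p * time_ratio m A p tau).
exists (fun tau => (- Dsum m p * time_ratio m A p tau) *
  ((1 - Dsum m p * time_ratio m A p tau) +
   time_ratio m A p tau * growth_defect m A p tau)).
refine (conj _ (conj _ (conj _ (conj _ _)))); auto.
- intros tau; pose proof (proper_time_pos m A p tau hchi) as hT.
  pose proof (lapse_pos m A p tau) as hN.
  unfold log_time_excess; evar_last.
  + apply (is_derive_minus
      (fun tau => ln (proper_time m A p tau) - Dsum m p * tau)
      (fun _ => ln (lapse_coef m A p / Dsum m p))); [|apply @is_derive_const].
    apply (is_derive_minus (fun tau => ln (proper_time m A p tau))
      (fun tau => Dsum m p * tau)).
    * apply (is_derive_comp ln (proper_time m A p));
        [apply is_derive_ln; auto|apply is_derive_proper_time; auto].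
    * apply is_derive_scal, @is_derive_id.
  + unfold minus, plus, opp, scal, zero, one; simpl; unfold mult; simpl.
    unfold time_ratio; field; lra.
- intros tau; pose proof (time_ratio_pos m A p tau hchi); evar_last.
  + apply (is_derive_minus (fun _ => 1) (fun tau => Dsum m p * time_ratio m A p tau));
      [apply @is_derive_const|apply is_derive_scal, is_derive_time_ratio; auto].
  + rewrite growth_defect_eq; unfold minus, plus, opp, zero; simpl; field; lra.
- apply decays_ext with (fun tau =>
    ln (Dsum m p * time_ratio m A p tau) + log_lapse_excess m A p tau).
  { intros; symmetry; apply log_time_excess_eq; auto. }
  apply decays_plus; [|apply decays_log_lapse_excess; auto].
  destruct hr as [C hC]; exists C; intros tau ht.
  eapply Rle_trans; [|apply hC; auto].
  pose proof (time_ratio_bounds m A p tau hchi) as [h1 _].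
  (* As [x >= 1], its logarithm lies between 0 and [x - 1], whose decay is known. *)
  set (x := Dsum m p * time_ratio m A p tau).
  assert (hx : 1 <= x).
  { unfold x; rewrite <- (Rinv_r (Dsum m p)) by lra; apply Rmult_le_compat_l; lra. }
  rewrite Rabs_minus_sym, !Rabs_pos_eq; [|lra|].
  + rewrite <- (ln_exp (x - 1)); apply ln_le; [lra|].
    pose proof (exp_ineq1_le (x - 1)); lra.
  + rewrite <- ln_1; apply ln_le; lra.
- apply (decays_mult b (fun tau => 1 - Dsum m p * time_ratio m A p tau +
    time_ratio m A p tau * growth_defect m A p tau)).
  + apply bounded_fut_mult; auto using bounded_fut_const.
  + apply decays_plus; auto; apply decays_mult; auto.
    apply decays_growth_defect; auto.
Qed.

(** * From [tau] to proper time *)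

(** As [t <= N <= K exp (D tau)], the factor [exp (- eps D tau)] is at most [K ^ eps * t ^ (- eps)].
    The threshold is the proper time of [tau = 0], where the decay bounds begin. *)
Lemma is_O_infty_of_decays m A p eps f :
  (forall r, (1 <= r <= m)%nat -> 0 < Fcoef A p r) ->
  (forall r, (1 <= r <= m)%nat -> 0 < chi p r) -> 0 <= eps ->
  decays (eps * Dsum m p) f -> is_O_infty eps (fun t => f (tau_of m A p t)).
Proof.
intros hk hchi heps [C hC].
destruct (lapse_bounds m A p hk hchi) as [K hK].
pose proof (proper_time_pos m A p 0 hchi) as hT0.
assert (hKpos : 0 < K).
{ specialize (hK 0 (Rle_refl 0)); rewrite Rmult_0_r, exp_0 in hK.
  pose proof (lapse_pos m A p 0); lra. }
exists (C * exp (eps * ln K)), (proper_time m A p 0); split; auto.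
intros t ht.
assert (htau : 0 <= tau_of m A p t) by (apply tau_of_ge; auto; lra).
assert (hT := proper_time_tau_of m A p t hchi ltac:(lra)).
set (tau := tau_of m A p t) in *.
specialize (hC tau htau); destruct (hK tau htau) as [_ hu].
assert (htN : t <= K * exp (Dsum m p * tau)).
{ pose proof (proper_time_bounds m A p tau hchi) as [_ hb]; rewrite hT in hb.
  unfold lapse in hu; lra. }
apply ln_le in htN; [|lra].
rewrite ln_mult, ln_exp in htN by auto using exp_pos.
eapply Rle_trans; [exact hC|].
assert (0 <= C).
{ pose proof (Rabs_pos (f tau)); pose proof (exp_pos (- (eps * Dsum m p * tau))); nra. }
rewrite (Rmult_assoc C); apply Rmult_le_compat_l; auto.
unfold Rpower; rewrite <- exp_plus; apply exp_le; nra.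
Qed.

Lemma locally_pos t : 0 < t -> locally t (fun x => 0 < x).
Proof. intros ht; apply (open_gt 0); auto. Qed.

Lemma is_O_infty_ext_pos eps f g :
  (forall t, 0 < t -> f t = g t) -> is_O_infty eps f -> is_O_infty eps g.
Proof.
intros hfg (C & T & hT & hC); exists C, T; split; auto.
intros t ht; rewrite <- hfg by lra; auto.
Qed.

(** Along [tau_of] the derivative [g' / s] in [tau] becomes [g' / (s N) = g' / t], so multiplication
    by [t] recovers [g']; this is applied to [f], then to [f1]. *)
Lemma is_O2_infty_of_decays2 m A p eps f :
  (forall r, (1 <= r <= m)%nat -> 0 < Fcoef A p r) ->
  (forall r, (1 <= r <= m)%nat -> 0 < chi p r) -> 0 <= eps ->
  decays2 (time_ratio m A p) (eps * Dsum m p) f ->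
  is_O2_infty eps (fun t => f (tau_of m A p t)).
Proof.
intros hk hchi heps (f1 & f2 & d1 & d2 & b0 & b1 & b2).
assert (hd : forall g g' : R -> R,
  (forall tau, is_derive g tau (g' tau / time_ratio m A p tau)) ->
  forall t, 0 < t -> is_derive (fun x : R => g (tau_of m A p x)) t (g' (tau_of m A p t) / t)).
{ intros g g' hg t ht; evar_last; [apply is_derive_comp_tau_of; auto|].
  simpl; unfold time_ratio; rewrite proper_time_tau_of by auto.
  pose proof (lapse_pos m A p (tau_of m A p t)); field; lra. }
assert (t1 : forall t, 0 < t ->
  f1 (tau_of m A p t) = t_deriv (fun x => f (tau_of m A p x)) t).
{ intros t ht; unfold t_deriv.
  rewrite (is_derive_unique _ _ _ (hd f f1 d1 t ht)); field; lra. }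
assert (D2 : forall t, 0 < t -> is_derive
  (t_deriv (fun x => f (tau_of m A p x))) t (f2 (tau_of m A p t) / t)).
(* The first [t_deriv] is identified with [f1] only for [t > 0], so the second derivative goes
   through a local equality. *)
{ intros t ht; apply is_derive_ext_loc with (fun x => f1 (tau_of m A p x));
    [|apply hd; auto].
  apply filter_imp with (2 := locally_pos t ht); exact t1. }
split; [|split; [|split]].
- intros t ht; split; eexists; [apply hd|apply D2]; eauto.
- apply is_O_infty_of_decays; auto.
- apply is_O_infty_ext_pos with (1 := t1); apply is_O_infty_of_decays; auto.
- apply is_O_infty_ext_pos with (fun t => f2 (tau_of m A p t));
    [|apply is_O_infty_of_decays; auto].
  intros t ht; unfold t_deriv at 1.
  rewrite (is_derive_unique _ _ _ (D2 t ht)); field; lra.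
Qed.

(** * Late-time form of the scale factors *)

Definition scale_coef (m : nat) (A p : nat -> R) (a : nat) : R :=
  match a with
  | O => A 0%nat / lapse_coef m A p
  | S _ => A a * sqrt (Fcoef A p (block a))
  end.

Definition log_scale_excess (m : nat) (A p : nat -> R) (a : nat) (tau : R) : R :=
  match a with
  | O => - 1 * log_lapse_excess m A p tau
  | S _ => / 2 * log_F_excess A p (block a) tau
  end.

Lemma scale_coef_pos m A p a :
  (forall a, (a <= 2 * m)%nat -> 0 < A a) ->
  (forall r, (1 <= r <= m)%nat -> 0 < Fcoef A p r) ->
  (a <= 2 * m)%nat -> 0 < scale_coef m A p a.
Proof.
intros hA hk ha; pose proof (hA a ha); destruct a as [|a]; unfold scale_coef.
- apply Rdiv_lt_0_compat; auto using lapse_coef_pos.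
- apply Rmult_lt_0_compat; auto; apply sqrt_lt_R0, hk.
  apply block_cases; lia.
Qed.

(** [P_a * D] is [p_0 - S], with [S] the sum of the [chi_r], or [p_a + chi_r]: the rate of
    [exp (p_a tau)] combined with that of the factors [sqrt F_r]. [D tau] is kept together because
    [ln t] replaces it later. *)
Lemma scale_factor_eq m A p a tau :
  (forall r, (1 <= r <= m)%nat -> 0 < Fcoef A p r) ->
  Dsum m p <> 0 -> (a <= 2 * m)%nat ->
  scale_factor m A p a tau =
  scale_coef m A p a * exp (Pfut m p a * (Dsum m p * tau)) *
  exp (log_scale_excess m A p a tau).
Proof.
intros hk hD ha.
destruct a as [|a]; unfold scale_factor, scale_coef, log_scale_excess, Pfut.
- rewrite prod_1_inv, prod_sqrt_F_eq by auto.
  replace ((p 0%nat - sum_n_m (chi p) 1 m) / Dsum m p * (Dsum m p * tau))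
    with (p 0%nat * tau + - (sum_n_m (chi p) 1 m * tau)) by (field; auto).
  replace (- 1 * log_lapse_excess m A p tau)
    with (- log_lapse_excess m A p tau) by ring.
  rewrite exp_plus, !exp_Ropp.
  pose proof (lapse_coef_pos m A p hk).
  pose proof (exp_pos (sum_n_m (chi p) 1 m * tau)).
  pose proof (exp_pos (log_lapse_excess m A p tau)).
  field; lra.
- rewrite sqrt_F_eq by (apply hk, block_cases; lia).
  replace ((p (S a) + chi p (block (S a))) / Dsum m p * (Dsum m p * tau))
    with (p (S a) * tau + chi p (block (S a)) * tau) by (field; auto).
  rewrite exp_plus.
  replace (/ 2 * log_F_excess A p (block (S a)) tau)
    with (log_F_excess A p (block (S a)) tau / 2) by field.
  ring.
Qed.

Lemma decays2_log_scale_excess m A p a b :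
  (forall r, (1 <= r <= m)%nat -> 0 < Fcoef A p r) ->
  (forall r, (1 <= r <= m)%nat -> 0 < chi p r) ->
  (forall r, (1 <= r <= m)%nat -> 0 <= b <= 2 * chi p r) ->
  (a <= 2 * m)%nat ->
  decays2 (time_ratio m A p) b (log_scale_excess m A p a).
Proof.
intros hk hchi hb ha; destruct a as [|a]; unfold log_scale_excess.
- apply decays2_ext with
    (fun tau => - / 2 * sum_n_m (fun r => log_F_excess A p r tau) 1 m).
  { intros; unfold log_lapse_excess; field. }
  apply decays2_scal, decays2_sum; intros; apply decays2_log_F_excess; auto.
- destruct (block_cases m (S a) ltac:(lia)) as [hr _].
  apply decays2_scal, decays2_log_F_excess; auto.
Qed.

(** * The scalar density parameter *)

Lemma theta_eq m A p t :
  (forall a, (a <= 2 * m)%nat -> 0 < A a) ->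
  (forall r, (1 <= r <= m)%nat -> 0 < chi p r) ->
  sum_n_m p 0 (2 * m) = 1 -> 0 < t ->
  theta m A p t =
  lapse_growth m A p (tau_of m A p t) / lapse m A p (tau_of m A p t).
Proof.
intros hA hchi hsum ht; unfold theta.
rewrite (sum_n_m_ext_loc _ (fun a => / lapse m A p (tau_of m A p t) *
  scale_growth m A p a (tau_of m A p t))).
- rewrite sum_n_m_Rscal, sum_scale_growth by auto; apply Rmult_comm.
- intros a ha; unfold scale_factor_t at 1.
  rewrite (is_derive_unique _ _ _ (is_derive_comp_tau_of m A p _ t _ hchi ht
    (is_derive_scale_factor m A p a (tau_of m A p t)))).
  unfold scale_factor_t.
  pose proof (scale_factor_pos m A p a (tau_of m A p t) hA ltac:(lia)).
  pose proof (lapse_pos m A p (tau_of m A p t)).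
  change_eq_R; field; lra.
Qed.

Lemma Omega_phi_eq m A p q phi0 t :
  (1 <= m)%nat ->
  (forall a, (a <= 2 * m)%nat -> 0 < A a) ->
  (forall r, (1 <= r <= m)%nat -> 0 < chi p r) ->
  sum_n_m p 0 (2 * m) = 1 -> 0 < t ->
  Omega_phi m A p q phi0 t =
  INR (2 * m + 1) * q ^ 2 / (INR (2 * m + 1) - 1) /
  lapse_growth m A p (tau_of m A p t) ^ 2.
Proof.
intros hm hA hchi hsum ht.
unfold Omega_phi, rho_phi, rho_crit; rewrite theta_eq by auto.
assert (hd : is_derive (scalar_field q phi0) (tau_of m A p t) q)
  by (unfold scalar_field; auto_derive; auto; ring).
unfold scalar_field_t.
rewrite (is_derive_unique _ _ _ (is_derive_comp_tau_of m A p _ t _ hchi ht hd)).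
pose proof (lapse_pos m A p (tau_of m A p t)).
pose proof (lapse_growth_ge_1 m A p (tau_of m A p t) hchi).
assert (1 < INR (2 * m + 1)) by (apply (lt_INR 1); lia).
field; lra.
Qed.

(** * Limits at both ends of proper time *)

Lemma filterlim_tau_of_0 m A p :
  (forall r, (1 <= r <= m)%nat -> 0 < chi p r) ->
  filterlim (tau_of m A p) (at_right 0) (Rbar_locally m_infty).
Proof.
intros hchi P [M hM].
(* [M - 1] rather than [M]: neighbourhoods of [-oo] ask for a strict inequality, and [tau_of_le]
   yields a weak one. *)
exists (mkposreal _ (proper_time_pos m A p (M - 1) hchi)); intros t hball ht.
apply Rabs_def2 in hball; unfold minus, plus, opp in hball; simpl in hball.
apply hM; assert (tau_of m A p t <= M - 1); [|lra].
apply tau_of_le; auto; lra.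
Qed.

Lemma filterlim_tau_of_infty m A p :
  (forall r, (1 <= r <= m)%nat -> 0 < chi p r) ->
  filterlim (tau_of m A p) (Rbar_locally p_infty) (Rbar_locally p_infty).
Proof.
intros hchi P [M hM]; exists (proper_time m A p (M + 1)); intros t ht.
apply hM; assert (M + 1 <= tau_of m A p t); [|lra].
pose proof (proper_time_pos m A p (M + 1) hchi).
apply tau_of_ge; auto; lra.
Qed.

(** One statement for both ends: [l = 1] in the past gives the value 1, [l = 0] in the future gives
    [D]. *)
Lemma is_lim_lapse_growth m A p (x : Rbar) (l : R) :
  (forall r, (1 <= r <= m)%nat -> is_lim (fun tau => / F A p r tau) x l) ->
  is_lim (lapse_growth m A p) x (1 + (1 - l) * sum_n_m (chi p) 1 m).
Proof.
intros hl; unfold lapse_growth, block_growth.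
apply (is_lim_plus' (fun _ => 1) (block_growth m A p) x); [apply is_lim_const|].
unfold block_growth; induction m as [|m IH].
- apply is_lim_ext with (fun _ => 0).
  { intros; rewrite sum_n_m_zero by lia; reflexivity. }
  rewrite sum_n_m_zero by lia; unfold zero; simpl.
  rewrite Rmult_0_r; apply is_lim_const.
- apply is_lim_ext with (fun tau =>
    sum_n_m (fun r => chi p r * (1 - / F A p r tau)) 1 m +
    chi p (S m) * (1 - / F A p (S m) tau)).
  { intros; rewrite sum_n_Sm by lia; reflexivity. }
  rewrite sum_n_Sm by lia; unfold plus; simpl.
  rewrite Rmult_plus_distr_l.
  apply is_lim_plus'; [apply IH; intros; apply hl; lia|].
  rewrite (Rmult_comm (1 - l)).
  apply (is_lim_scal_l (fun tau => 1 - / F A p (S m) tau) (chi p (S m)) x (1 - l)).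
  apply is_lim_minus'; [apply is_lim_const|apply hl; lia].
Qed.

Lemma is_lim_inv_F_m_infty A p r :
  0 < chi p r -> is_lim (fun tau => / F A p r tau) m_infty 1.
Proof.
intros hc.
assert (hF : is_lim (F A p r) m_infty 1).
{ unfold F; fold (Fcoef A p r).
  replace (Finite 1) with (Finite (1 + Fcoef A p r * 0)) by (f_equal; ring).
  apply is_lim_plus'; [apply is_lim_const|].
  apply (is_lim_scal_l _ (Fcoef A p r) m_infty 0).
  apply is_lim_comp with m_infty; [apply is_lim_exp_m| |].
  - evar_last.
    + apply (is_lim_scal_l (fun x => x) (2 * chi p r) m_infty m_infty), is_lim_id.
    + simpl; destruct (Rle_dec 0 (2 * chi p r)) as [h|h]; [|lra].
      destruct (Rle_lt_or_eq_dec 0 (2 * chi p r) h); [auto|lra].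
  (* The inner function is finite, so it never equals its infinite limit. *)
  - exists 0; intros; discriminate. }
replace (Finite 1) with (Rbar_inv (Finite 1)) by (simpl; f_equal; apply Rinv_1).
apply is_lim_inv; auto; intros h; injection h; lra.
Qed.

(** By [1 + x <= exp x], [F_r] dominates a linear function of positive slope. *)
Lemma is_lim_inv_F_p_infty A p r :
  0 < Fcoef A p r -> 0 < chi p r -> is_lim (fun tau => / F A p r tau) p_infty 0.
Proof.
intros hk hc.
assert (hF : is_lim (F A p r) p_infty p_infty).
{ apply is_lim_le_p_loc with (fun tau => Fcoef A p r * (2 * chi p r) * tau).
  - exists 0; intros tau _; unfold F; fold (Fcoef A p r).
    pose proof (exp_ineq1_le (2 * chi p r * tau)); nra.
  - evar_last.
    + apply (is_lim_scal_l (fun x => x) (Fcoef A p r * (2 * chi p r)) p_infty p_infty),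
        is_lim_id.
    + assert (hpos : 0 < Fcoef A p r * (2 * chi p r)) by nra.
      simpl; destruct (Rle_dec 0 (Fcoef A p r * (2 * chi p r))) as [h|h]; [|lra].
      destruct (Rle_lt_or_eq_dec 0 (Fcoef A p r * (2 * chi p r)) h); [auto|lra]. }
apply (is_lim_inv (F A p r) p_infty p_infty); auto; discriminate.
Qed.

(** A general filter on [t] covers the limits at 0 from the right and at infinity at once; [t > 0]
    is asked only eventually along it. *)
Lemma filterlim_Omega_phi m A p q phi0 (Fl : (R -> Prop) -> Prop) {hFl : Filter Fl}
    (x : Rbar) (l : R) :
  Fl (fun t => 0 < t) ->
  (1 <= m)%nat ->
  (forall a, (a <= 2 * m)%nat -> 0 < A a) ->
  (forall r, (1 <= r <= m)%nat -> 0 < chi p r) ->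
  sum_n_m p 0 (2 * m) = 1 ->
  filterlim (tau_of m A p) Fl (Rbar_locally' x) ->
  is_lim (lapse_growth m A p) x l -> l <> 0 ->
  filterlim (Omega_phi m A p q phi0) Fl
    (locally (INR (2 * m + 1) * q ^ 2 / (INR (2 * m + 1) - 1) / l ^ 2)).
Proof.
intros hpos hm hA hchi hsum htau hlim hl.
set (c := INR (2 * m + 1) * q ^ 2 / (INR (2 * m + 1) - 1)).
apply (filterlim_ext_loc (fun t => c / lapse_growth m A p (tau_of m A p t) ^ 2)).
{ apply filter_imp with (2 := hpos); intros t ht; symmetry; apply Omega_phi_eq; auto. }
apply (filterlim_comp _ _ _ (tau_of m A p) (fun tau => c / lapse_growth m A p tau ^ 2)
  _ _ _ htau).
change (is_lim (fun tau => c / lapse_growth m A p tau ^ 2) x (c / l ^ 2)).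
apply (is_lim_scal_l (fun tau => / lapse_growth m A p tau ^ 2) c x (/ l ^ 2)).
apply (is_lim_inv (fun tau => lapse_growth m A p tau ^ 2) x (l ^ 2)).
2:{ intros h; injection h; apply (pow_nonzero l 2 hl). }
apply is_lim_ext with (fun tau => lapse_growth m A p tau * lapse_growth m A p tau).
{ intros; ring. }
replace (l ^ 2) with (l * l) by ring;
  apply (is_lim_mult (lapse_growth m A p) (lapse_growth m A p) x l l); simpl; auto.
Qed.

(** * Future Kasner regime and the two limits of [Omega_phi] *)

Theorem proposition8p8 (m : nat) (A p : nat -> R) (q phi0 : R)
  (hm : (1 <= m)%nat)
  (hA : forall a : nat, (a <= 2 * m)%nat -> 0 < A a)
  (hsum : sum_n_m p 0 (2 * m) = 1)
  (hsum2 : sum_n_m (fun a => p a ^ 2) 0 (2 * m) + q ^ 2 = 1)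
  (hchi : forall r : nat, (1 <= r <= m)%nat -> 0 < chi p r) :
  let n := INR (2 * m + 1) in
  let D := Dsum m p in
  let P := Pfut m p in
  let Q := Qfut m p q in
  let eps_max := Rmin 1 (2 * min_1 (chi p) m / D) in
  sum_n_m P 0 (2 * m) = 1 /\
  sum_n_m (fun a => P a ^ 2) 0 (2 * m) + Q ^ 2 = 1 /\
  (forall r : nat, (1 <= r <= m)%nat ->
     1 + P 0%nat - P (2 * r - 1)%nat - P (2 * r)%nat = - chi p r / D) /\
  (exists Aplus : nat -> R,
     forall a : nat, (a <= 2 * m)%nat ->
       0 < Aplus a /\
       exists E : R -> R,
         (forall t, 0 < t ->
            scale_factor_t m A p a t = Aplus a * Rpower t (P a) * (1 + E t)) /\
         (forall eps, 0 < eps < eps_max -> is_O2_infty eps E)) /\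
  (exists phiplus : R,
     exists E : R -> R,
       (forall t, 0 < t ->
          scalar_field_t m A p q phi0 t = Q * ln t + phiplus + E t) /\
       (forall eps, 0 < eps < eps_max -> is_O2_infty eps E)) /\
  filterlim (Omega_phi m A p q phi0) (at_right 0) (locally (n * q ^ 2 / (n - 1))) /\
  filterlim (Omega_phi m A p q phi0) (Rbar_locally p_infty)
    (locally (n * q ^ 2 / (n - 1) / D ^ 2)).
Proof.
intros n D P Q eps_max.
assert (hD : 1 <= D) by (apply Dsum_ge_1; auto).
assert (hD0 : D <> 0) by lra.
assert (hk : forall r, (1 <= r <= m)%nat -> 0 < Fcoef A p r)
  by (intros; apply (Fcoef_pos m); auto).
(* A rate [eps] in [t] is the rate [b = eps * D] in [tau]: [eps < 1] gives [b < D], and the other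
   bound gives [b <= 2 chi_r] for every [r]. *)
assert (heps : forall eps, 0 < eps < eps_max ->
  0 <= eps * D < D /\ (forall r, (1 <= r <= m)%nat -> eps * D <= 2 * chi p r)).
{ intros eps [h0 h1].
  assert (eps < 1) by (eapply Rlt_le_trans; [exact h1|apply Rmin_l]).
  assert (h2 : eps < 2 * min_1 (chi p) m / D)
    by (eapply Rlt_le_trans; [exact h1|apply Rmin_r]).
  split; [nra|intros r hr].
  pose proof (min_1_le (chi p) m r hr).
  apply (Rmult_lt_compat_r D) in h2; [|lra].
  unfold Rdiv in h2; rewrite Rmult_assoc, Rinv_l in h2 by auto; lra. }
assert (hln : forall t, 0 < t -> ln t = D * tau_of m A p t +
  ln (lapse_coef m A p / D) + log_time_excess m A p (tau_of m A p t)).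
{ intros t ht; unfold log_time_excess; rewrite proper_time_tau_of by auto.
  fold D; ring. }
split; [apply sum_Pfut; auto|].
split; [apply sum_sq_Pfut; auto|].
split; [intros r hr; apply chi_Pfut; auto; lia|].
split; [|split; [|split]].
(* Substituting [D tau = ln t - ln (c / D) - log_time_excess] into [exp (P_a D tau)] leaves the
   constant [(c / D) ^ (- P_a)]. *)
- exists (fun a => scale_coef m A p a * exp (- (P a * ln (lapse_coef m A p / D)))).
  intros a ha; split.
  { apply Rmult_lt_0_compat; [apply scale_coef_pos; auto|apply exp_pos]. }
  (* One error serves all [eps]; it gathers the corrections of the scale factor and of [ln t]. *)
  set (e := fun tau =>
    exp (log_scale_excess m A p a tau + - P a * log_time_excess m A p tau) - 1).
  exists (fun t => e (tau_of m A p t)); split.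
  + intros t ht; unfold scale_factor_t, Rpower; rewrite (hln t ht).
    rewrite scale_factor_eq by auto; fold D; fold (P a).
    set (tau := tau_of m A p t); unfold e.
    replace (1 + (exp (log_scale_excess m A p a tau +
      - P a * log_time_excess m A p tau) - 1)) with
      (exp (log_scale_excess m A p a tau + - P a * log_time_excess m A p tau)) by ring.
    rewrite !Rmult_assoc, <- !exp_plus; do 2 f_equal; ring.
  + intros eps he; destruct (heps eps he) as [hb hr].
    apply (is_O2_infty_of_decays2 m A p eps e); auto; [lra|]; fold D.
    apply decays2_exp_m1; [lra|].
    apply decays2_plus; [|apply decays2_scal].
    * apply decays2_log_scale_excess; auto; intros r hr'; split; [lra|auto].
    * apply decays2_log_time_excess; auto.
(* By [q = Q * D] the field is [Q * (D tau) + phi0], with [D tau] replaced as before. *)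
- exists (phi0 - Q * ln (lapse_coef m A p / D)).
  exists (fun t => - Q * log_time_excess m A p (tau_of m A p t)); split.
  + intros t ht; rewrite (hln t ht); unfold scalar_field_t, scalar_field.
    replace q with (Q * D) by (unfold Q, Qfut; fold D; field; auto); ring.
  + intros eps he; destruct (heps eps he) as [hb hr].
    apply (is_O2_infty_of_decays2 m A p eps
      (fun tau => - Q * log_time_excess m A p tau)); auto; [lra|]; fold D.
    apply decays2_scal, decays2_log_time_excess; auto.
- replace (n * q ^ 2 / (n - 1)) with (n * q ^ 2 / (n - 1) / 1 ^ 2)
    by (unfold Rdiv; rewrite pow1, Rinv_1; ring).
  apply (filterlim_Omega_phi m A p q phi0 (at_right 0) m_infty); auto.
  + exists (mkposreal 1 Rlt_0_1); auto.
  + apply filterlim_tau_of_0; auto.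
  + replace 1 with (1 + (1 - 1) * sum_n_m (chi p) 1 m) by ring.
    apply is_lim_lapse_growth; intros; apply is_lim_inv_F_m_infty; auto.
- apply (filterlim_Omega_phi m A p q phi0 (Rbar_locally p_infty) p_infty); auto.
  + exists 0; auto.
  + apply filterlim_tau_of_infty; auto.
  + replace D with (1 + (1 - 0) * sum_n_m (chi p) 1 m) by (unfold D, Dsum; ring).
    apply is_lim_lapse_growth; intros; apply is_lim_inv_F_p_infty; auto.
Qed.
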